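(* Axiom CSP implies Axiom BPIT (the Boolean prime ideal theorem) in Boolean toposes. That is, in every Boolean topos in which Axiom CSP holds, Axiom BPIT holds.
   Context: All notions below are read in the internal language of a Boolean topos (a topos whose internal logic is classical); ''set'' means object of the topos. Relational structures. A relational signature $\Sigma$ consists of relation symbols $R/k$ ($R$ a symbol, $k$ its arity); a structure over $\Sigma$ is a set together with an interpretation of each $R/k\in\Sigma$ as a $k$-ary relation on it. A homomorphism of structures is a function preserving all relations. Finiteness. For a set $A$, $K(A)$ is the sub-join-semilattice of the powerset $P(A)$ generated by the singletons and the empty set. $A$ is (Kuratowski-)finite if it is the top element in $K(A)$. A finite cardinal is a set of the form $\{0,1,\dots,n-1\}$. Finitary partial functions. A finitary relation from $A$ to $B$ is an element $R\in K(A\times B)\subseteq P(A\times B)$. It is a partial function if $R(a,b)\wedge R(a,b')$ implies $b=b'$. Finitary homomorphisms. Let $\mathcal{A},\mathcal{B}$ be structures, with underlying sets $A,B$, over a common relational signature $\Sigma$. A relational homomorphism from $\mathcal{A}$ to $\mathcal{B}$ is a relation $f\in P(A\times B)$ such that for every $R/k\in\Sigma$: $f(a_1,b_1)\wedge\dots\wedge f(a_k,b_k)\wedge R(a_1,\dots,a_k)$ implies $R(b_1,\dots,b_k)$. A finitary homomorphism is a finitary partial function which is also a relational homomorphism; the set of all of them is denoted $\hom(\underline{\mathcal{A}},\mathcal{B})$. The map $\gamma_0:\hom(\underline{\mathcal{A}},\mathcal{B})\to K(A)$ assigns to a finitary homomorphism its domain. A set $H\subseteq\hom(\underline{\mathcal{A}},\mathcal{B})$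 is jointly total if for every finite $A_0\in K(A)$ there exists $h\in H$ with $A_0\subseteq\gamma_0(h)$. Axiom CSP. For every relational signature $\Sigma$ and every pair of structures $\mathcal{V},\mathcal{D}$ over $\Sigma$ such that the underlying set $D$ of $\mathcal{D}$ is a finite cardinal, the following are equivalent: (i) there exists a homomorphism from $\mathcal{V}$ to $\mathcal{D}$; (ii) the set of finitary homomorphisms $\hom(\underline{\mathcal{V}},\mathcal{D})$ is jointly total. Boolean algebras. Consider an algebra $\mathcal{B}=\langle B,1,\wedge,\neg\rangle$ with a constant $1$, a binary operation $\wedge:B\times B\to B$ and a unary operation $\neg:B\to B$, and define $a\leq b\Leftrightarrow a=a\wedge b$. $\mathcal{B}$ is called a Boolean algebra if $\leq$ is a partial order on $B$ with finite meets given by $\wedge$ and greatest element $1$, and $\neg\neg b=b$ for every $b\in B$. One puts $0=\neg 1$ and $a\vee b=\neg(\neg a\wedge\neg b)$. $\mathcal{B}$ is non-trivial if $0\neq 1$. For the purposes of Axiom CSP, a Boolean algebra is treated as a relational structure with predicates $\mathrm{top}(x)\Leftrightarrow x=1$, $\mathrm{and}(x,y,z)\Leftrightarrow x\wedge y=z$, $\mathrm{not}(x,y)\Leftrightarrow\neg x=y$. Axiom BPIT. For every non-trivial Boolean algebra $\mathcal{B}$ there is a homomorphism $\mathcal{B}\to 2$ to the initial Boolean algebra $2=1\sqcup 1$ (here $1$ is the terminal object).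
   Formalization: The stated definition of Boolean algebra also admits non-Boolean examples (the three-element chain with reversing negation), for which BPIT fails; the laws a ∧ ¬a = 0 and a ∧ (b ∨ c) = (a ∧ b) ∨ (a ∧ c) are added, giving the standard notion. *)

(* Defs.v *)
(* No library is used: there is no topos theory in MathComp or Stdlib. *)
Set Implicit Arguments.
Unset Strict Implicit.
Unset Printing Implicit Defensive.

(** * Elementary toposes *)

Declare Scope cat_scope.
Delimit Scope cat_scope with cat.
Local Open Scope cat_scope.

Record category := Category {
  Ob :> Type;
  Hom : Ob -> Ob -> Type;
  idm : forall A, Hom A A;
  comp : forall A B C, Hom B C -> Hom A B -> Hom A C;
  comp_idl : forall A B (f : Hom A B), comp (idm B) f = f;
  comp_idr : forall A B (f : Hom A B), comp f (idm A) = f;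
  comp_assoc : forall A B C D (h : Hom C D) (g : Hom B C) (f : Hom A B),
    comp h (comp g f) = comp (comp h g) f
}.
Arguments idm {c A}.
Notation "A ~> B" := (Hom A B) (at level 90, no associativity) : cat_scope.
Notation "g \o f" := (comp g f) (at level 50, left associativity) : cat_scope.

Definition monic (C : category) (A B : C) (m : A ~> B) : Prop :=
  forall (W : C) (x y : W ~> A), m \o x = m \o y -> x = y.

Definition is_coproduct (C : category) (A B S : C) (i : A ~> S) (j : B ~> S)
  : Prop :=
  forall (X : C) (f : A ~> X) (g : B ~> X),
    exists! h : S ~> X, h \o i = f /\ h \o j = g.

(* [phi] classifies the subobject [m]: the square with sides [m], [phi] and
   [tr : I ~> O] is a pullback.  [bang] is the map to the terminal object. *)
Definition classifies (C : category) (I O : C) (bang : forall A : C, A ~> I)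
    (tr : I ~> O) (A X : C) (m : A ~> X) (phi : X ~> O) : Prop :=
  phi \o m = tr \o bang A /\
  forall (W : C) (x : W ~> X), phi \o x = tr \o bang W ->
    exists u : W ~> A, m \o u = x.

(* A cartesian closed category with finite limits (terminal object, binary
   products, equalizers) and a subobject classifier.  No natural numbers
   object is assumed. *)
Record topos := Topos {
  cat :> category;
  one : cat;
  bang : forall A : cat, A ~> one;
  bang_uniq : forall (A : cat) (f : A ~> one), f = bang A;
  prod : cat -> cat -> cat;
  pi1 : forall A B : cat, prod A B ~> A;
  pi2 : forall A B : cat, prod A B ~> B;
  pairing : forall W A B : cat, (W ~> A) -> (W ~> B) -> (W ~> prod A B);
  pi1_pairing : forall (W A B : cat) (f : W ~> A) (g : W ~> B),
    pi1 A B \o pairing f g = f;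
  pi2_pairing : forall (W A B : cat) (f : W ~> A) (g : W ~> B),
    pi2 A B \o pairing f g = g;
  pairing_uniq : forall (W A B : cat) (h : W ~> prod A B),
    pairing (pi1 A B \o h) (pi2 A B \o h) = h;
  equ : forall A B : cat, (A ~> B) -> (A ~> B) -> cat;
  equ_map : forall (A B : cat) (f g : A ~> B), equ f g ~> A;
  equ_eq : forall (A B : cat) (f g : A ~> B),
    f \o equ_map f g = g \o equ_map f g;
  equ_univ : forall (A B : cat) (f g : A ~> B) (W : cat) (x : W ~> A),
    f \o x = g \o x -> exists! u : W ~> equ f g, equ_map f g \o u = x;
  expo : cat -> cat -> cat;
  ev : forall A B : cat, prod (expo A B) A ~> B;
  curry : forall C A B : cat, (prod C A ~> B) -> (C ~> expo A B);
  ev_curry : forall (C A B : cat) (f : prod C A ~> B),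
    ev A B \o pairing (curry f \o pi1 C A) (pi2 C A) = f;
  curry_uniq : forall (C A B : cat) (f : prod C A ~> B) (g : C ~> expo A B),
    ev A B \o pairing (g \o pi1 C A) (pi2 C A) = f -> g = curry f;
  Omega : cat;
  tr : one ~> Omega;
  chi : forall (A X : cat) (m : A ~> X), monic m -> (X ~> Omega);
  chi_classifies : forall (A X : cat) (m : A ~> X) (mm : monic m),
    classifies bang tr m (chi mm);
  chi_uniq : forall (A X : cat) (m : A ~> X) (mm : monic m) (phi : X ~> Omega),
    classifies bang tr m phi -> phi = chi mm
}.
Arguments one {t}.
Arguments pi1 {t A B}.
Arguments pi2 {t A B}.
Arguments ev {t A B}.
Arguments Omega {t}.
Arguments tr {t}.
Arguments bang {t A}.
Infix "×" := prod (at level 40, left associativity) : cat_scope.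

(** * The internal (Mitchell-Benabou) language *)

(* A term of type [A] in context [G] is a morphism [G ~> A], a formula is a term
   of type [Omega]; binders extend the context [G] to [G × X] and hand the last
   projection to their body.  The logical connectives are the impredicative
   ones of Lambek and Scott, defined from equality and comprehension. *)

Definition pow (T : topos) (X : T) : T := expo X Omega.

Definition term (T : topos) (G A : T) : Type := G ~> A.
Notation "G ⊢ A" := (term G A) (at level 91, no associativity) : cat_scope.

(* [↑t] is the term [t] weakened to the current context. *)
Class extends (T : topos) (G D : T) := ext_map : D ~> G.
Global Hint Mode extends ! ! ! : typeclass_instances.
Global Instance ext_refl (T : topos) (G : T) : extends G G | 0 := idm.
Global Instance ext_step (T : topos) (G D X : T) (e : extends G D) :
  extends G (D × X) | 1 := @ext_map T G D e \o pi1.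
Definition lift (T : topos) (G D A : T) {e : extends G D} (t : G ⊢ A) : D ⊢ A :=
  t \o @ext_map T G D e.
Notation "↑ t" := (lift t) (at level 1, t at level 1, format "↑ t") : cat_scope.

Lemma diag_monic (T : topos) (A : T) :
  monic (pairing (idm : A ~> A) (idm : A ~> A)).
Proof.
intros W x y E; apply (f_equal (comp pi1)) in E.
now rewrite !comp_assoc, !pi1_pairing, !comp_idl in E.
Qed.

Section Logic.
Variables (T : topos).
Implicit Types (G X Y A : T).

Definition const G A (c : one ~> A) : G ⊢ A := c \o bang.

Definition tpair G A B (a : G ⊢ A) (b : G ⊢ B) : G ⊢ A × B := pairing a b.
Definition tfst G A B (p : G ⊢ A × B) : G ⊢ A := pi1 \o p.
Definition tsnd G A B (p : G ⊢ A × B) : G ⊢ B := pi2 \o p.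

Definition eq_ G A (a b : G ⊢ A) : G ⊢ Omega :=
  chi (@diag_monic T A) \o pairing a b.

Definition mem G X (x : G ⊢ X) (S : G ⊢ pow X) : G ⊢ Omega :=
  ev \o pairing S x.

Definition compr G X (phi : (G × X ⊢ X) -> (G × X ⊢ Omega)) : G ⊢ pow X :=
  curry (phi pi2).

Definition top_ G : G ⊢ Omega := const G tr.

Definition and_ G (p q : G ⊢ Omega) : G ⊢ Omega :=
  eq_ (tpair p q) (tpair (top_ G) (top_ G)).

Definition imp_ G (p q : G ⊢ Omega) : G ⊢ Omega := eq_ (and_ p q) p.

Definition iff_ G (p q : G ⊢ Omega) : G ⊢ Omega := and_ (imp_ p q) (imp_ q p).

Definition all_ G X (phi : (G × X ⊢ X) -> (G × X ⊢ Omega)) : G ⊢ Omega :=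
  eq_ (compr phi) (compr (fun _ => top_ (G × X))).

Definition bot_ G : G ⊢ Omega := all_ (fun t : G × Omega ⊢ Omega => t).

Definition not_ G (p : G ⊢ Omega) : G ⊢ Omega := imp_ p (bot_ G).

Definition or_ G (p q : G ⊢ Omega) : G ⊢ Omega :=
  all_ (fun t : G × Omega ⊢ Omega =>
    imp_ (and_ (imp_ ↑p t) (imp_ ↑q t)) t).

Definition ex_ G X (phi : (G × Omega × X ⊢ X) -> (G × Omega × X ⊢ Omega))
  : G ⊢ Omega :=
  all_ (fun t : G × Omega ⊢ Omega =>
    imp_ (all_ (fun x : G × Omega × X ⊢ X => imp_ (phi x) ↑t)) t).

Definition all_in_ G X (S : G ⊢ pow X)
    (phi : (G × X ⊢ X) -> (G × X ⊢ Omega)) : G ⊢ Omega :=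
  all_ (fun x : G × X ⊢ X => imp_ (mem x ↑S) (phi x)).

Definition ex_in_ G X (S : G ⊢ pow X)
    (phi : (G × Omega × X ⊢ X) -> (G × Omega × X ⊢ Omega)) : G ⊢ Omega :=
  ex_ (fun x : G × Omega × X ⊢ X => and_ (mem x ↑S) (phi x)).

Definition valid (phi : one ⊢ Omega) : Prop := phi = top_ one.

End Logic.

Declare Scope topos_scope.
Delimit Scope topos_scope with topos.
Notation "⟨ a , b ⟩" := (tpair a b) (at level 0, a at level 99, b at level 99)
  : topos_scope.
Notation "a ≡ b" := (eq_ a b) (at level 70, no associativity) : topos_scope.
Notation "x ∈ S" := (mem x S) (at level 70, no associativity) : topos_scope.
Notation "⊤" := (top_ _) (at level 0) : topos_scope.
Notation "⊥" := (bot_ _) (at level 0) : topos_scope.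
Notation "¬ p" := (not_ p) (at level 75, right associativity) : topos_scope.
Notation "p ∧ q" := (and_ p q) (at level 80, right associativity) : topos_scope.
Notation "p ∨ q" := (or_ p q) (at level 85, right associativity) : topos_scope.
Notation "p ⇒ q" := (imp_ p q) (at level 95, right associativity) : topos_scope.
Notation "p ⇔ q" := (iff_ p q) (at level 95, no associativity) : topos_scope.
Notation "{{ x : X | phi }}" := (compr (X := X) (fun x => phi%topos))
  (at level 0, x name, X at level 60, phi at level 200) : topos_scope.
Notation "∀ x : X , phi" := (all_ (X := X) (fun x => phi%topos))
  (at level 200, x name, X at level 60, phi at level 200) : topos_scope.
Notation "∃ x : X , phi" := (ex_ (X := X) (fun x => phi%topos))
  (at level 200, x name, X at level 60, phi at level 200) : topos_scope.
Notation "∀ x ∈ S , phi" := (all_in_ S%topos (fun x => phi%topos))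
  (at level 200, x name, S at level 60, phi at level 200) : topos_scope.
Notation "∃ x ∈ S , phi" := (ex_in_ S%topos (fun x => phi%topos))
  (at level 200, x name, S at level 60, phi at level 200) : topos_scope.

Local Open Scope topos_scope.

(* The internal logic of [T] is classical. *)
Definition boolean_topos (T : topos) : Prop :=
  valid (∀ p : (@Omega T), p ∨ ¬ p).

(** * Sets, relations and functions *)

(* A set is an element [A] of some [pow X].  A subset of [X] in context [G] is
   a subobject of [G × X], that is, up to isomorphism and for varying [X], an
   arbitrary object over [G]; so "for every set" is rendered by quantifying
   over the object [X] and, internally, over [A : pow X].  Functions between
   sets are identified with their graphs. *)

Section Sets.
Variables (T : topos) (G : T).
Implicit Types (X Y Q : T).

Definition full X : G ⊢ pow X := {{ x : X | ⊤ }}.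
Definition empty X : G ⊢ pow X := {{ x : X | ⊥ }}.
Definition single X (a : G ⊢ X) : G ⊢ pow X := {{ x : X | x ≡ ↑a }}.
Definition union X (A B : G ⊢ pow X) : G ⊢ pow X :=
  {{ x : X | x ∈ ↑A ∨ x ∈ ↑B }}.
Definition subset X (A B : G ⊢ pow X) : G ⊢ Omega := ∀ x ∈ A, x ∈ ↑B.
Definition cart X Y (A : G ⊢ pow X) (B : G ⊢ pow Y) : G ⊢ pow (X × Y) :=
  {{ p : X × Y | tfst p ∈ ↑A ∧ tsnd p ∈ ↑B }}.
Definition dom X Y (f : G ⊢ pow (X × Y)) : G ⊢ pow X :=
  {{ x : X | ∃ y : Y, ⟨↑x, y⟩ ∈ ↑f }}.
Definition fiber X Y (f : G ⊢ pow (X × Y)) (x : G ⊢ X) : G ⊢ pow Y :=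
  {{ y : Y | ⟨↑x, y⟩ ∈ ↑f }}.

Definition single_valued X Y (f : G ⊢ pow (X × Y)) : G ⊢ Omega :=
  ∀ x : X, ∀ y : Y, ∀ y' : Y, ⟨↑x, ↑y⟩ ∈ ↑f ∧ ⟨↑x, y'⟩ ∈ ↑f ⇒ ↑y ≡ y'.

Definition is_function X Y (A : G ⊢ pow X) (B : G ⊢ pow Y)
    (f : G ⊢ pow (X × Y)) : G ⊢ Omega :=
  subset f (cart A B) ∧ single_valued f ∧ subset A (dom f).

End Sets.
Arguments full {T G X}.
Arguments empty {T G X}.

(** * Finiteness *)

(* [F] is a sub-join-semilattice (with least element) of the powerset of [A]
   that contains the singletons. *)
Definition subsemilattice (T : topos) (G X : T) (A : G ⊢ pow X) (F : G ⊢ pow (pow X)) : G ⊢ Omega :=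
  (∀ S ∈ F, subset S ↑A) ∧
  empty ∈ F ∧
  (∀ a ∈ A, single a ∈ ↑F) ∧
  (∀ S ∈ F, ∀ S' ∈ ↑F, union ↑S S' ∈ ↑F).

Definition K (T : topos) (G X : T) (A : G ⊢ pow X) : G ⊢ pow (pow X) :=
  {{ S : pow X | ∀ F : pow (pow X), subsemilattice ↑A F ⇒ ↑S ∈ F }}.

Definition finite (T : topos) (G X : T) (A : G ⊢ pow X) : G ⊢ Omega := A ∈ K A.

Definition strict_linear_order (T : topos) (G X : T) (A : G ⊢ pow X) (lt : G ⊢ pow (X × X))
  : G ⊢ Omega :=
  subset lt (cart A A) ∧
  (∀ x : X, ¬ ⟨x, x⟩ ∈ ↑lt) ∧
  (∀ x : X, ∀ y : X, ∀ z : X,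
    ⟨↑x, ↑y⟩ ∈ ↑lt ∧ ⟨↑y, z⟩ ∈ ↑lt ⇒ ⟨↑x, z⟩ ∈ ↑lt) ∧
  (∀ x ∈ A, ∀ y ∈ ↑A, ⟨↑x, y⟩ ∈ ↑lt ∨ ↑x ≡ y ∨ ⟨y, ↑x⟩ ∈ ↑lt).

(* The finite cardinal {0 < 1 < ... < n-1}, up to its unique order isomorphism;
   this form does not refer to a natural numbers object. *)
Definition finite_cardinal (T : topos) (G X : T) (A : G ⊢ pow X) (lt : G ⊢ pow (X × X))
  : G ⊢ Omega :=
  finite A ∧ strict_linear_order A lt.

(** * Relational structures *)

(* A signature is a set [Sg] of symbols with, for each symbol [R], a finite
   cardinal [fiber ar R], with order [fiber lt R], as its arity.  A [k]-tuple in
   [A] is a function [k -> A].  A structure on [A] is a family [I] of relations,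
   [fiber I R] being the set of tuples related by [R]. *)

Section Structures.
Variables (T : topos) (G : T) (S Q : T).
Variables (Sg : G ⊢ pow S) (ar : G ⊢ pow (S × Q)).

Definition signature (lt : G ⊢ pow (S × (Q × Q))) : G ⊢ Omega :=
  ∀ R ∈ Sg, finite_cardinal (fiber ↑ar R) (fiber ↑lt R).

Definition structure (X : T) (A : G ⊢ pow X) (I : G ⊢ pow (S × pow (Q × X)))
  : G ⊢ Omega :=
  ∀ R ∈ Sg, ∀ a ∈ fiber ↑I R, is_function (fiber ↑ar ↑R) ↑A a.

Section Maps.
Variables (X Y : T).
Variables (A : G ⊢ pow X) (I : G ⊢ pow (S × pow (Q × X))).
Variables (B : G ⊢ pow Y) (J : G ⊢ pow (S × pow (Q × Y))).

(* f(a_1,b_1), ..., f(a_k,b_k) and R(a_1,...,a_k) imply R(b_1,...,b_k) *)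
Definition preserves (f : G ⊢ pow (X × Y)) : G ⊢ Omega :=
  ∀ R ∈ Sg, ∀ a : pow (Q × X), ∀ b : pow (Q × Y),
    is_function (fiber ↑ar ↑R) ↑A ↑a ∧
    is_function (fiber ↑ar ↑R) ↑B b ∧
    (∀ i ∈ fiber ↑ar ↑R, ∀ x : X, ∀ y : Y,
       ⟨↑i, ↑x⟩ ∈ ↑a ∧ ⟨↑i, y⟩ ∈ ↑b ⇒ ⟨↑x, y⟩ ∈ ↑f) ∧
    ↑a ∈ fiber ↑I ↑R
    ⇒ b ∈ fiber ↑J ↑R.

Definition homomorphism (f : G ⊢ pow (X × Y)) : G ⊢ Omega :=
  is_function A B f ∧ preserves f.

Definition relational_homomorphism (f : G ⊢ pow (X × Y)) : G ⊢ Omega :=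
  subset f (cart A B) ∧ preserves f.

Definition finitary_homomorphism (f : G ⊢ pow (X × Y)) : G ⊢ Omega :=
  f ∈ K (cart A B) ∧ single_valued f ∧ relational_homomorphism f.

End Maps.
End Structures.

Definition finitary_homs (T : topos) (G S Q X Y : T)
    (Sg : G ⊢ pow S) (ar : G ⊢ pow (S × Q))
    (A : G ⊢ pow X) (I : G ⊢ pow (S × pow (Q × X)))
    (B : G ⊢ pow Y) (J : G ⊢ pow (S × pow (Q × Y)))
  : G ⊢ pow (pow (X × Y)) :=
  {{ f : pow (X × Y) | finitary_homomorphism ↑Sg ↑ar ↑A ↑I ↑B ↑J f }}.

Definition jointly_total (T : topos) (G X Y : T) (A : G ⊢ pow X)
    (H : G ⊢ pow (pow (X × Y))) : G ⊢ Omega :=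
  ∀ A0 ∈ K A, ∃ h ∈ ↑H, subset ↑A0 (dom h).

Definition Axiom_CSP (T : topos) : Prop :=
  forall S Q X Y : T, valid (
    ∀ Sg : pow S, ∀ ar : pow (S × Q), ∀ lt : pow (S × (Q × Q)),
    ∀ V : pow X, ∀ I : pow (S × pow (Q × X)),
    ∀ D : pow Y, ∀ ltD : pow (Y × Y), ∀ J : pow (S × pow (Q × Y)),
      signature ↑Sg ↑ar ↑lt ∧
      structure ↑Sg ↑ar ↑V ↑I ∧
      structure ↑Sg ↑ar ↑D J ∧
      finite_cardinal ↑D ↑ltD
      ⇒ ((∃ h : pow (X × Y), homomorphism ↑Sg ↑ar ↑V ↑I ↑D ↑J h)
         ⇔ jointly_total ↑V (finitary_homs ↑Sg ↑ar ↑V ↑I ↑D J))).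

(** * Boolean algebras *)

(* The operations of an algebra are given by their graphs: [m] holds at
   [⟨⟨a, b⟩, c⟩] when the meet of [a] and [b] is [c], and [n] at [⟨a, b⟩] when
   the negation of [a] is [b]. *)

Section BooleanAlgebras.
Variables (T : topos) (G X : T).
Variables (B : G ⊢ pow X).
Variables (e : G ⊢ X) (m : G ⊢ pow (X × X × X)) (n : G ⊢ pow (X × X)).

Definition algebra : G ⊢ Omega :=
  e ∈ B ∧ is_function (cart B B) B m ∧ is_function B B n.

Definition ba_le : G ⊢ pow (X × X) :=
  {{ p : X × X | ⟨p, tfst p⟩ ∈ ↑m }}.

Definition ba_join : G ⊢ pow (X × X × X) :=
  {{ p : X × X × X | ∃ a : X, ∃ b : X, ∃ c : X,
       ⟨tfst (tfst ↑p), ↑a⟩ ∈ ↑n ∧ ⟨tsnd (tfst ↑p), ↑b⟩ ∈ ↑n ∧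
       ⟨⟨↑a, ↑b⟩, c⟩ ∈ ↑m ∧ ⟨c, tsnd ↑p⟩ ∈ ↑n }}.

Definition ba_order : G ⊢ Omega :=
  (∀ a ∈ B, ⟨a, a⟩ ∈ ↑ba_le) ∧
  (∀ a ∈ B, ∀ b ∈ ↑B, ⟨↑a, b⟩ ∈ ↑ba_le ∧ ⟨b, ↑a⟩ ∈ ↑ba_le ⇒ ↑a ≡ b) ∧
  (∀ a ∈ B, ∀ b ∈ ↑B, ∀ c ∈ ↑B,
     ⟨↑a, ↑b⟩ ∈ ↑ba_le ∧ ⟨↑b, c⟩ ∈ ↑ba_le ⇒ ⟨↑a, c⟩ ∈ ↑ba_le).

Definition ba_meets : G ⊢ Omega :=
  (∀ a ∈ B, ∀ b ∈ ↑B, ∀ c ∈ ↑B, ⟨⟨↑a, ↑b⟩, c⟩ ∈ ↑m ⇒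
     ⟨c, ↑a⟩ ∈ ↑ba_le ∧ ⟨c, ↑b⟩ ∈ ↑ba_le ∧
     (∀ d ∈ ↑B, ⟨d, ↑a⟩ ∈ ↑ba_le ∧ ⟨d, ↑b⟩ ∈ ↑ba_le ⇒ ⟨d, ↑c⟩ ∈ ↑ba_le)) ∧
  (∀ a ∈ B, ⟨a, ↑e⟩ ∈ ↑ba_le).

Definition ba_involution : G ⊢ Omega :=
  ∀ a ∈ B, ∀ b ∈ ↑B, ⟨↑a, b⟩ ∈ ↑n ⇒ ⟨b, ↑a⟩ ∈ ↑n.

(* The meet of [a] and the negation of [a] is 0, the negation of 1. *)
Definition ba_complement : G ⊢ Omega :=
  ∀ a ∈ B, ∀ b ∈ ↑B, ∀ c ∈ ↑B,
    ⟨↑a, ↑b⟩ ∈ ↑n ∧ ⟨⟨↑a, ↑b⟩, c⟩ ∈ ↑m ⇒ ⟨↑e, c⟩ ∈ ↑n.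

(* If b ∨ c = d, a ∧ d = u, a ∧ b = v and a ∧ c = w, then v ∨ w = u. *)
Definition ba_distributive : G ⊢ Omega :=
  ∀ a ∈ B, ∀ b ∈ ↑B, ∀ c ∈ ↑B, ∀ d ∈ ↑B,
  ∀ u ∈ ↑B, ∀ v ∈ ↑B, ∀ w ∈ ↑B,
    ⟨⟨↑b, ↑c⟩, ↑d⟩ ∈ ↑ba_join ∧ ⟨⟨↑a, ↑d⟩, ↑u⟩ ∈ ↑m ∧
    ⟨⟨↑a, ↑b⟩, ↑v⟩ ∈ ↑m ∧ ⟨⟨↑a, ↑c⟩, w⟩ ∈ ↑m
    ⇒ ⟨⟨↑v, w⟩, ↑u⟩ ∈ ↑ba_join.

(* Order, meets and involution alone do not make a Boolean algebra (reverse the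
   three-element chain), hence the last two conjuncts. *)
Definition boolean_algebra : G ⊢ Omega :=
  algebra ∧ ba_order ∧ ba_meets ∧ ba_involution ∧
  ba_complement ∧ ba_distributive.

Definition nontrivial : G ⊢ Omega := ∀ z : X, ⟨↑e, z⟩ ∈ ↑n ⇒ ¬ z ≡ ↑e.

End BooleanAlgebras.

Definition ba_homomorphism (T : topos) (G X Y : T)
    (B : G ⊢ pow X) (e : G ⊢ X) (m : G ⊢ pow (X × X × X)) (n : G ⊢ pow (X × X))
    (B' : G ⊢ pow Y) (e' : G ⊢ Y) (m' : G ⊢ pow (Y × Y × Y))
    (n' : G ⊢ pow (Y × Y)) (h : G ⊢ pow (X × Y)) : G ⊢ Omega :=
  is_function B B' h ∧
  ⟨e, e'⟩ ∈ h ∧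
  (∀ a : X, ∀ b : X, ∀ c : X, ∀ a' : Y, ∀ b' : Y, ∀ c' : Y,
     ⟨↑a, ↑a'⟩ ∈ ↑h ∧ ⟨↑b, ↑b'⟩ ∈ ↑h ∧ ⟨↑c, c'⟩ ∈ ↑h ∧
     ⟨⟨↑a, ↑b⟩, ↑c⟩ ∈ ↑m ⇒ ⟨⟨↑a', ↑b'⟩, c'⟩ ∈ ↑m') ∧
  (∀ a : X, ∀ b : X, ∀ a' : Y, ∀ b' : Y,
     ⟨↑a, ↑a'⟩ ∈ ↑h ∧ ⟨↑b, b'⟩ ∈ ↑h ∧ ⟨↑a, ↑b⟩ ∈ ↑n ⇒ ⟨↑a', b'⟩ ∈ ↑n').

(* The Boolean algebra 2 on a coproduct [two] of two copies of the terminal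
   object, with 0 and 1 given by the coproduct injections. *)
Section Two.
Variables (T : topos) (G two : T) (i0 i1 : (one : T) ~> two).

Definition meet2 : G ⊢ pow (two × two × two) :=
  {{ p : two × two × two |
       (tfst (tfst p) ≡ const _ i1 ∧ tsnd p ≡ tsnd (tfst p)) ∨
       (tfst (tfst p) ≡ const _ i0 ∧ tsnd p ≡ const _ i0) }}.

Definition not2 : G ⊢ pow (two × two) :=
  {{ p : two × two |
       (tfst p ≡ const _ i0 ∧ tsnd p ≡ const _ i1) ∨
       (tfst p ≡ const _ i1 ∧ tsnd p ≡ const _ i0) }}.

End Two.

Definition Axiom_BPIT (T : topos) : Prop :=
  forall (two : T) (i0 i1 : one ~> two), is_coproduct i0 i1 ->
  forall X : T, valid (
    ∀ B : pow X, ∀ e : X, ∀ m : pow (X × X × X), ∀ n : pow (X × X),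
      boolean_algebra ↑B ↑e ↑m n ∧ nontrivial ↑e n
      ⇒ ∃ h : pow (X × two),
          ba_homomorphism ↑B ↑e ↑m ↑n
            full (const _ i1) (meet2 _ i0 i1) (not2 _ i0 i1) h).

(* Main.v *)
(* The operations of a Boolean algebra are encoded by the single quaternary
   relation [a ∧ b = c, ¬ a = d] with arity [two × two], so that a homomorphism
   to the structure [two] is a homomorphism of Boolean algebras (it preserves 1
   because [1 ∧ 0 = 0]).  For joint totality, one shows by induction on a finite
   set [S] that below every [k ≠ 0] there is some [k' ≠ 0] that lies, for each
   [x] in [S], below [x] or below [¬ x]: by excluded middle either [k ∧ x ≠ 0]
   or [k ≤ ¬ x].  Sending [x] to 1 or 0 accordingly gives a finitary partial map
   defined on [S], and it is a homomorphism because [k' ≠ 0].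
   Internal statements are handled by Kripke-Joyal semantics: elements and
   formulas are morphisms out of a stage, and the rules for the connectives
   that change the stage restrict the whole context along the new map. *)
Require Import Defs.
From Stdlib Require Import Setoid.
Set Implicit Arguments.
Unset Strict Implicit.
Unset Printing Implicit Defensive.
Local Open Scope cat_scope.
Local Open Scope topos_scope.

(** * Kripke-Joyal semantics *)

(** Internal existence and disjunction hold only locally: a witness or a branch appears after a
    change of stage. Hence the elimination lemmas below carry an arbitrary goal [q], and values of
    functions are never extracted once and for all. The induction has to carry a nonzero [k] and not
    just a finite partial homomorphism. A partial homomorphism can get stuck: if [x ∧ y = 0] and 0
    is outside the domain, sending both [x] and [y] to 1 may violate nothing yet cannot be extended
    to 0. With a nonzero [k] below all chosen literals, an extension always exists, and every
    conceivable defect (two values at one argument, a violated operation) would put [k] below some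
    element and its negation, making it 0. The four slots of [two × two] hold both arguments of the
    meet, its result and the negation of the first argument. This arity is built from the coproduct
    alone, without numerals, and leaves a signature with a single symbol. *)

Section KripkeJoyal.
Variable T : topos.
Implicit Types (G W X Y : T).

(** The forcing relation of Kripke-Joyal semantics, at stage [W]. *)
Definition tru W (p : W ~> Omega) : Prop := p = top_ W.

Lemma comp_pi1_pairing W A B D (x : A ~> D) (f : W ~> A) (g : W ~> B) :
  (x \o pi1) \o pairing f g = x \o f.
Proof. now rewrite <- comp_assoc, pi1_pairing. Qed.

Lemma comp_pi2_pairing W A B D (x : B ~> D) (f : W ~> A) (g : W ~> B) :
  (x \o pi2) \o pairing f g = x \o g.
Proof. now rewrite <- comp_assoc, pi2_pairing. Qed.

Lemma pairing_comp V W A B (f : W ~> A) (g : W ~> B) (h : V ~> W) :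
  pairing f g \o h = pairing (f \o h) (g \o h).
Proof.
rewrite <- (pairing_uniq (pairing f g \o h)), !comp_assoc.
now rewrite pi1_pairing, pi2_pairing.
Qed.

Lemma pairing_pi A B : @pairing T _ A B pi1 pi2 = idm.
Proof. now rewrite <- (pairing_uniq idm), !comp_idr. Qed.

Lemma const_comp V W A (c : one ~> A) (f : V ~> W) :
  const W c \o f = const V c.
Proof.
unfold const; rewrite <- comp_assoc; f_equal; apply bang_uniq.
Qed.

Lemma top_comp V W (f : V ~> W) : top_ W \o f = top_ V.
Proof. apply const_comp. Qed.

Lemma tru_sub V W (f : V ~> W) (p : W ~> Omega) : tru p -> tru (p \o f).
Proof. unfold tru; intros ->; apply top_comp. Qed.

Lemma eq_comp V W A (a b : W ~> A) (f : V ~> W) :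
  eq_ a b \o f = eq_ (a \o f) (b \o f).
Proof. unfold eq_; now rewrite <- comp_assoc, pairing_comp. Qed.

(** The pair is classified as true exactly when it factors through the diagonal, and then both
    components equal the factoring map. *)
Lemma tru_eq W A (a b : W ~> A) : tru (eq_ a b) <-> a = b.
Proof.
destruct (chi_classifies (@diag_monic T A)) as [sq univ].
unfold tru, eq_, top_, const; split.
- intros E; destruct (univ _ _ E) as [u Eu].
  pose proof (f_equal (comp pi1) Eu) as E1; pose proof (f_equal (comp pi2) Eu) as E2.
  rewrite comp_assoc, !pi1_pairing, comp_idl in E1.
  rewrite comp_assoc, !pi2_pairing, comp_idl in E2.
  now rewrite <- E1, <- E2.
- intros ->.
  replace (pairing b b) with (pairing (idm : A ~> A) idm \o b)
    by now rewrite pairing_comp, !comp_idl.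
  rewrite comp_assoc, sq, <- comp_assoc; f_equal; apply bang_uniq.
Qed.

Lemma equ_map_monic A B (f g : A ~> B) : monic (@equ_map T A B f g).
Proof.
intros W x y E.
destruct (@equ_univ T A B f g W (equ_map (t := T) f g \o x)) as [u [_ uniq]].
- now rewrite !comp_assoc, equ_eq.
- now rewrite <- (uniq x eq_refl); apply uniq.
Qed.

(** Two formulas forced at the same stages classify the same subobject of [W], the equalizer of [p]
    with truth; classifying maps are unique. *)
Lemma omega_ext W (p q : W ~> Omega) :
  (forall V (f : V ~> W), tru (p \o f) <-> tru (q \o f)) -> p = q.
Proof.
intros H; set (m := equ_map (t := T) p (top_ W)).
assert (Em : tru (p \o m))
  by (unfold tru, m; rewrite equ_eq; apply top_comp).
assert (cl : forall r : W ~> Omega,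
  (forall V (f : V ~> W), tru (p \o f) <-> tru (r \o f)) ->
  classifies (@bang T) tr m r).
{ intros r Hr; split; [now apply Hr|].
  intros V x E; apply Hr in E.
  destruct (@equ_univ T _ _ p (top_ W) V x) as [u [Eu _]]; [|now exists u].
  rewrite top_comp; exact E. }
transitivity (chi (equ_map_monic (f := p) (g := top_ W))).
- now apply chi_uniq, cl.
- now symmetry; apply chi_uniq, cl.
Qed.

Lemma tpair_comp V W A B (a : W ~> A) (b : W ~> B) (f : V ~> W) :
  tpair a b \o f = tpair (a \o f) (b \o f).
Proof. apply pairing_comp. Qed.

Lemma tfst_comp V W A B (p : W ~> A × B) (f : V ~> W) :
  tfst p \o f = tfst (p \o f).
Proof. symmetry; apply comp_assoc. Qed.

Lemma tsnd_comp V W A B (p : W ~> A × B) (f : V ~> W) :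
  tsnd p \o f = tsnd (p \o f).
Proof. symmetry; apply comp_assoc. Qed.

Lemma tfst_tpair W A B (a : W ~> A) (b : W ~> B) : tfst (tpair a b) = a.
Proof. apply pi1_pairing. Qed.

Lemma tsnd_tpair W A B (a : W ~> A) (b : W ~> B) : tsnd (tpair a b) = b.
Proof. apply pi2_pairing. Qed.

Lemma tpair_eta W A B (p : W ~> A × B) : tpair (tfst p) (tsnd p) = p.
Proof. apply pairing_uniq. Qed.

Lemma tpair_inj W A B (a a' : W ~> A) (b b' : W ~> B) :
  tpair a b = tpair a' b' -> a = a' /\ b = b'.
Proof.
intros E; split.
- apply (f_equal (@tfst T W A B)) in E; now rewrite !tfst_tpair in E.
- apply (f_equal (@tsnd T W A B)) in E; now rewrite !tsnd_tpair in E.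
Qed.

Lemma mem_comp V W X (x : W ~> X) (S : W ~> pow X) (f : V ~> W) :
  mem x S \o f = mem (x \o f) (S \o f).
Proof. unfold mem; now rewrite <- comp_assoc, pairing_comp. Qed.

Lemma and_comp V W (p q : W ~> Omega) (f : V ~> W) :
  and_ p q \o f = and_ (p \o f) (q \o f).
Proof. unfold and_; now rewrite eq_comp, !tpair_comp, !top_comp. Qed.

Lemma imp_comp V W (p q : W ~> Omega) (f : V ~> W) :
  imp_ p q \o f = imp_ (p \o f) (q \o f).
Proof. unfold imp_; now rewrite eq_comp, and_comp. Qed.

Lemma iff_comp V W (p q : W ~> Omega) (f : V ~> W) :
  iff_ p q \o f = iff_ (p \o f) (q \o f).
Proof. unfold iff_; now rewrite and_comp, !imp_comp. Qed.

(* [phi] in [compr phi], [all_ phi] and [ex_ phi] only matters through its value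
   at the bound variable [pi2]; the following variants take this value. *)
Definition under V W X (f : V ~> W) : V × X ~> W × X := pairing (f \o pi1) pi2.
Arguments under {V W X} f.
Definition comprT W X (p : W × X ~> Omega) : W ~> pow X := curry p.
Definition allT W X (p : W × X ~> Omega) : W ~> Omega :=
  eq_ (comprT p) (comprT (top_ (W × X))).
Definition exT W X (p : W × Omega × X ~> Omega) : W ~> Omega :=
  allT (imp_ (allT (imp_ p (pi2 \o pi1))) pi2).

Lemma comprE W X phi : @compr T W X phi = comprT (phi pi2).
Proof. reflexivity. Qed.

Lemma allE W X phi : @all_ T W X phi = allT (phi pi2).
Proof. reflexivity. Qed.

Lemma exE W X phi : @ex_ T W X phi = exT (phi pi2).
Proof.
unfold ex_, exT, lift; rewrite !allE; cbv beta.
do 5 f_equal. cbv [ext_map ext_step ext_refl]. now rewrite comp_idl.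
Qed.

Lemma comp_pi1_under V W X D (x : W ~> D) (f : V ~> W) :
  (x \o pi1) \o (under f : V × X ~> W × X) = (x \o f) \o pi1.
Proof. unfold under; now rewrite comp_pi1_pairing, comp_assoc. Qed.

Lemma pi2_under V W X (f : V ~> W) : pi2 \o (under f : V × X ~> W × X) = pi2.
Proof. apply pi2_pairing. Qed.

(** Transposition is natural: the restricted map evaluates to the restricted body, so [curry_uniq]
    identifies it. *)
Lemma comprT_comp V W X (p : W × X ~> Omega) (f : V ~> W) :
  comprT p \o f = comprT (p \o under f).
Proof.
apply curry_uniq.
transitivity ((ev \o pairing (curry p \o pi1) pi2) \o under f);
  [|now rewrite ev_curry].
unfold under, comprT.
rewrite <- (comp_assoc ev), pairing_comp, <- !comp_assoc.
now rewrite pi1_pairing, pi2_pairing.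
Qed.

Lemma allT_comp V W X (p : W × X ~> Omega) (f : V ~> W) :
  allT p \o f = allT (p \o under f).
Proof. unfold allT; now rewrite eq_comp, !comprT_comp, top_comp. Qed.

Lemma exT_comp V W X (p : W × Omega × X ~> Omega) (f : V ~> W) :
  exT p \o f = exT (p \o under (under f)).
Proof.
unfold exT; rewrite allT_comp, imp_comp, allT_comp, imp_comp.
now rewrite comp_pi1_under, !pi2_under.
Qed.

Lemma tru_and W (p q : W ~> Omega) : tru (and_ p q) <-> tru p /\ tru q.
Proof.
unfold and_; rewrite tru_eq; split.
- apply tpair_inj.
- now intros [-> ->].
Qed.

Lemma tru_imp W (p q : W ~> Omega) :
  tru (imp_ p q) <-> forall V (f : V ~> W), tru (p \o f) -> tru (q \o f).
Proof.
unfold imp_; rewrite tru_eq; split.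
- intros E V f H; rewrite <- E, and_comp in H; now apply tru_and in H.
- intros H; apply omega_ext; intros V f; rewrite and_comp, tru_and.
  now split; [|split; [|apply H]].
Qed.

Lemma imp_elim W (p q : W ~> Omega) : tru (imp_ p q) -> tru p -> tru q.
Proof.
rewrite tru_imp; intros H; specialize (H W idm); now rewrite !comp_idr in H.
Qed.

Lemma curry_inj W A B (p q : W × A ~> B) : curry p = curry q -> p = q.
Proof.
intros E; now rewrite <- (ev_curry p), <- (ev_curry q), E.
Qed.

Lemma tru_all W X (p : W × X ~> Omega) :
  tru (allT p) <->
  forall V (f : V ~> W) (a : V ~> X), tru (p \o pairing f a).
Proof.
unfold allT; rewrite tru_eq; split.
- intros E V f a; apply curry_inj in E; rewrite E; apply top_comp.
- intros H; unfold comprT; f_equal.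
  (* The generic element: at stage [W × X] the projections stand for all instances at once. *)
  specialize (H _ pi1 pi2); now rewrite pairing_pi, comp_idr in H.
Qed.

Lemma all_elim W X (p : W × X ~> Omega) (a : W ~> X) :
  tru (allT p) -> tru (p \o pairing idm a).
Proof. now rewrite tru_all. Qed.

(** The context of [p] contains the truth value over which the impredicative [ex_] quantifies.
    Instantiating it with the goal [q] gives the elimination rule, which is why [q \o f] occupies
    that slot; [ex_intro] must allow any [t] there. *)
Lemma ex_elim W X (p : W × Omega × X ~> Omega) (q : W ~> Omega) :
  tru (exT p) ->
  (forall V (f : V ~> W) (a : V ~> X),
     tru (p \o pairing (pairing f (q \o f)) a) -> tru (q \o f)) ->
  tru q.
Proof.
intros H K; apply (all_elim q) in H.
rewrite imp_comp, pi2_pairing in H; apply (imp_elim H).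
rewrite allT_comp, tru_all; intros V f a.
rewrite <- comp_assoc, imp_comp, tru_imp; unfold under.
rewrite pairing_comp, comp_pi1_pairing, pi2_pairing, pairing_comp, comp_idl.
intros U g; rewrite comp_pi1_pairing, pi2_pairing.
rewrite <- comp_assoc, !pairing_comp, <- !comp_assoc; apply K.
Qed.

Lemma ex_intro W X (p : W × Omega × X ~> Omega) (a : W ~> X) :
  (forall V (f : V ~> W) (t : V ~> Omega),
     tru (p \o pairing (pairing f t) (a \o f))) ->
  tru (exT p).
Proof.
intros H; apply tru_all; intros V f t; rewrite imp_comp, pi2_pairing, tru_imp.
intros U g K; rewrite <- comp_assoc in K.
rewrite pairing_comp, allT_comp in K.
apply (all_elim (a \o (f \o g))) in K.
rewrite <- comp_assoc, imp_comp in K; unfold under in K.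
rewrite pairing_comp, comp_pi1_pairing, pi2_pairing, comp_idr in K.
rewrite comp_pi1_pairing, pi2_pairing in K.
now apply (imp_elim K).
Qed.

Lemma bot_comp V W (f : V ~> W) : bot_ W \o f = bot_ V.
Proof.
unfold bot_; rewrite !allE, allT_comp; f_equal; apply pi2_pairing.
Qed.

Lemma bot_elim W (q : W ~> Omega) : tru (bot_ W) -> tru q.
Proof. intros H; apply (all_elim q) in H; now rewrite pi2_pairing in H. Qed.

Lemma not_comp V W (p : W ~> Omega) (f : V ~> W) :
  not_ p \o f = not_ (p \o f).
Proof. unfold not_; now rewrite imp_comp, bot_comp. Qed.

Lemma tru_not W (p : W ~> Omega) :
  tru (not_ p) <-> forall V (f : V ~> W), tru (p \o f) -> tru (bot_ V).
Proof.
unfold not_; rewrite tru_imp.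
now split; intros H V f; specialize (H V f); rewrite bot_comp in *.
Qed.

Lemma not_elim W (p q : W ~> Omega) : tru (not_ p) -> tru p -> tru q.
Proof. intros H K; apply bot_elim, (imp_elim H K). Qed.

Lemma or_comp V W (p q : W ~> Omega) (f : V ~> W) :
  or_ p q \o f = or_ (p \o f) (q \o f).
Proof.
unfold or_, lift; cbv [ext_map ext_step ext_refl].
rewrite !allE, allT_comp, imp_comp, and_comp, !imp_comp.
unfold under; rewrite pi2_pairing, !comp_idl, <- !comp_assoc, pi1_pairing.
reflexivity.
Qed.

Lemma or_elim W (p q r : W ~> Omega) :
  tru (or_ p q) ->
  (forall V (f : V ~> W), tru (p \o f) -> tru (r \o f)) ->
  (forall V (f : V ~> W), tru (q \o f) -> tru (r \o f)) ->
  tru r.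
Proof.
unfold or_, lift; cbv [ext_map ext_step ext_refl]; rewrite allE.
intros H Hp Hq; apply (all_elim r) in H.
rewrite imp_comp, and_comp, !imp_comp, pi2_pairing, !comp_idl in H.
rewrite !comp_pi1_pairing, !comp_idr in H.
now apply (imp_elim H), tru_and; split; apply tru_imp.
Qed.

Lemma or_introl W (p q : W ~> Omega) : tru p -> tru (or_ p q).
Proof.
unfold or_, lift; cbv [ext_map ext_step ext_refl]; rewrite allE.
intros H; apply tru_all; intros V f t.
rewrite imp_comp, and_comp, !imp_comp, pi2_pairing, !comp_idl.
rewrite !comp_pi1_pairing, tru_imp; intros U g K.
rewrite and_comp, tru_and, !imp_comp in K; destruct K as [K _].
now apply (imp_elim K), tru_sub, tru_sub.
Qed.

Lemma or_intror W (p q : W ~> Omega) : tru q -> tru (or_ p q).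
Proof.
unfold or_, lift; cbv [ext_map ext_step ext_refl]; rewrite allE.
intros H; apply tru_all; intros V f t.
rewrite imp_comp, and_comp, !imp_comp, pi2_pairing, !comp_idl.
rewrite !comp_pi1_pairing, tru_imp; intros U g K.
rewrite and_comp, tru_and, !imp_comp in K; destruct K as [_ K].
now apply (imp_elim K), tru_sub, tru_sub.
Qed.

Lemma tru_top W : tru (top_ W).
Proof. reflexivity. Qed.

Lemma mem_compr W X (p : W × X ~> Omega) (x : W ~> X) :
  mem x (comprT p) = p \o pairing idm x.
Proof.
unfold mem, comprT.
transitivity ((ev \o pairing (curry p \o pi1) pi2) \o pairing idm x);
  [|now rewrite ev_curry].
rewrite <- (comp_assoc ev), pairing_comp, <- comp_assoc, pi1_pairing, pi2_pairing.
now rewrite comp_idr.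
Qed.

Lemma pow_ext W X (A B : W ~> pow X) :
  (forall V (f : V ~> W) (x : V ~> X),
     tru (mem x (A \o f)) <-> tru (mem x (B \o f))) -> A = B.
Proof.
intros H.
(* Every map into [pow X] is the transpose of its own evaluation, so it remains to compare two
   formulas by [omega_ext]. *)
rewrite (curry_uniq (g := A) eq_refl), (curry_uniq (g := B) eq_refl).
f_equal; apply omega_ext; intros V h.
rewrite <- !comp_assoc, !pairing_comp, <- !comp_assoc; apply H.
Qed.

End KripkeJoyal.
Arguments under {T V W X} f.

(** * Substitution in the internal language *)

Lemma comp_pi2_under (T : topos) (V W X D : T) (x : X ~> D) (f : V ~> W) :
  (x \o pi2) \o (under f : V × X ~> W × X) = x \o pi2.
Proof. now rewrite <- comp_assoc, pi2_under. Qed.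

Lemma pi1_under (T : topos) (V W X : T) (f : V ~> W) :
  pi1 \o (under f : V × X ~> W × X) = f \o pi1.
Proof. apply pi1_pairing. Qed.
#[local] Hint Rewrite comp_assoc comp_idl comp_idr comp_pi1_pairing
  comp_pi2_pairing pi1_pairing pi2_pairing pairing_comp comp_pi1_under
  comp_pi2_under pi1_under pi2_under const_comp top_comp bot_comp eq_comp
  tpair_comp tfst_comp tsnd_comp mem_comp and_comp imp_comp iff_comp not_comp
  or_comp comprT_comp allT_comp exT_comp comprE allE exE tfst_tpair tsnd_tpair
  mem_compr : kj.

Ltac push :=
  cbv beta delta [lift ext_map ext_step ext_refl all_in_ ex_in_ term];
  autorewrite with kj.
Ltac push_in H :=
  cbv beta delta [lift ext_map ext_step ext_refl all_in_ ex_in_ term] in H;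
  autorewrite with kj in H.

Section Congruence.
Variables (T : topos) (V W X : T) (s : V ~> W).

(** These congruences let [natural] descend through a formula one constructor at a time. Bodies of
    binders are functions, but only their value at the bound variable [pi2] matters, so that is
    where the two sides are compared. *)
Lemma compr_natural phi psi :
  phi pi2 \o under s = psi pi2 -> @compr T W X phi \o s = compr psi.
Proof. intros E; rewrite !comprE, comprT_comp; now f_equal. Qed.

Lemma all_natural phi psi :
  phi pi2 \o under s = psi pi2 -> @all_ T W X phi \o s = all_ psi.
Proof. intros E; rewrite !allE, allT_comp; now f_equal. Qed.

Lemma ex_natural phi psi :
  phi pi2 \o under (under s) = psi pi2 -> @ex_ T W X phi \o s = ex_ psi.
Proof. intros E; rewrite !exE, exT_comp; now f_equal. Qed.

Lemma and_natural (p q : W ~> Omega) p' q' :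
  p \o s = p' -> q \o s = q' -> and_ p q \o s = and_ p' q'.
Proof. intros <- <-; apply and_comp. Qed.

Lemma or_natural (p q : W ~> Omega) p' q' :
  p \o s = p' -> q \o s = q' -> or_ p q \o s = or_ p' q'.
Proof. intros <- <-; apply or_comp. Qed.

Lemma imp_natural (p q : W ~> Omega) p' q' :
  p \o s = p' -> q \o s = q' -> imp_ p q \o s = imp_ p' q'.
Proof. intros <- <-; apply imp_comp. Qed.

Lemma mem_natural (x : W ~> X) S x' S' :
  x \o s = x' -> S \o s = S' -> mem x S \o s = mem x' S'.
Proof. intros <- <-; apply mem_comp. Qed.

Lemma eq_natural (x y : W ~> X) x' y' :
  x \o s = x' -> y \o s = y' -> eq_ x y \o s = eq_ x' y'.
Proof. intros <- <-; apply eq_comp. Qed.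

Lemma tpair_natural Y (x : W ~> X) (y : W ~> Y) x' y' :
  x \o s = x' -> y \o s = y' -> tpair x y \o s = tpair x' y'.
Proof. intros <- <-; apply tpair_comp. Qed.

Lemma tfst_natural Y (p : W ~> X × Y) p' :
  p \o s = p' -> tfst p \o s = tfst p'.
Proof. intros <-; apply tfst_comp. Qed.

Lemma tsnd_natural Y (p : W ~> X × Y) p' :
  p \o s = p' -> tsnd p \o s = tsnd p'.
Proof. intros <-; apply tsnd_comp. Qed.

(** Restricting a weakened term agrees with weakening the restricted term; the new variable is
    untouched by [under s]. *)
Lemma lift_natural A D D' (t : D ~> A) (t' : D' ~> A)
    (e : extends D W) (e' : extends D' V) :
  lift (e := e) t \o s = lift (e := e') t' ->
  lift (e := @ext_step T D W X e) t \o under s =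
  lift (e := @ext_step T D' V X e') t'.
Proof.
unfold lift; cbv [ext_map ext_step]; intros E.
now rewrite !comp_assoc, comp_pi1_under, E.
Qed.

Lemma lift_natural_refl (t : W ~> X) (t' : V ~> X) :
  t \o s = t' ->
  lift (e := @ext_refl T W) t \o s = lift (e := @ext_refl T V) t'.
Proof. unfold lift; cbv [ext_map ext_refl]; intros <-; now rewrite !comp_idr. Qed.

End Congruence.

Ltac natural :=
  cbv beta;
  lazymatch goal with
  | |- compr _ \o _ = _ => apply compr_natural; natural
  | |- all_ _ \o _ = _ => apply all_natural; natural
  | |- ex_ _ \o _ = _ => apply ex_natural; natural
  | |- all_in_ _ _ \o _ = _ => unfold all_in_; natural
  | |- ex_in_ _ _ \o _ = _ => unfold ex_in_; natural
  | |- and_ _ _ \o _ = _ => apply and_natural; natural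
  | |- or_ _ _ \o _ = _ => apply or_natural; natural
  | |- imp_ _ _ \o _ = _ => apply imp_natural; natural
  | |- mem _ _ \o _ = _ => apply mem_natural; natural
  | |- eq_ _ _ \o _ = _ => apply eq_natural; natural
  | |- tpair _ _ \o _ = _ => apply tpair_natural; natural
  | |- tfst _ \o _ = _ => apply tfst_natural; natural
  | |- tsnd _ \o _ = _ => apply tsnd_natural; natural
  | |- const _ _ \o _ = _ => apply const_comp
  | |- @lift _ _ _ _ (@ext_step _ _ _ _ _) _ \o _ = _ => apply lift_natural; natural
  | |- @lift _ _ _ _ (@ext_refl _ _) _ \o _ = _ =>
      apply lift_natural_refl; natural
  | |- pi2 \o under _ = _ => apply pi2_under
  | |- _ => first [reflexivity | push; reflexivity]
  end.

(** * Stability of the defined notions under change of stage *)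

Section SetSubstitution.
Variables (T : topos) (V W : T) (s : V ~> W).
Implicit Types (S Q X Y : T).

Lemma full_comp X : (full : W ~> pow X) \o s = full.
Proof. unfold full; natural. Qed.

Lemma empty_comp X : (empty : W ~> pow X) \o s = empty.
Proof. unfold empty; natural. Qed.

Lemma single_comp X (a : W ~> X) : single a \o s = single (a \o s).
Proof. unfold single; natural. Qed.

Lemma union_comp X (A B : W ~> pow X) :
  union A B \o s = union (A \o s) (B \o s).
Proof. unfold union; natural. Qed.

Lemma subset_comp X (A B : W ~> pow X) :
  subset A B \o s = subset (A \o s) (B \o s).
Proof. unfold subset; natural. Qed.

Lemma cart_comp X Y (A : W ~> pow X) (B : W ~> pow Y) :
  cart A B \o s = cart (A \o s) (B \o s).
Proof. unfold cart; natural. Qed.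

Lemma dom_comp X Y (f : W ~> pow (X × Y)) : dom f \o s = dom (f \o s).
Proof. unfold dom; natural. Qed.

Lemma fiber_comp X Y (f : W ~> pow (X × Y)) (x : W ~> X) :
  fiber f x \o s = fiber (f \o s) (x \o s).
Proof. unfold fiber; natural. Qed.

Lemma single_valued_comp X Y (f : W ~> pow (X × Y)) :
  single_valued f \o s = single_valued (f \o s).
Proof. unfold single_valued; natural. Qed.

End SetSubstitution.
#[local] Hint Rewrite full_comp empty_comp single_comp union_comp subset_comp
  cart_comp dom_comp fiber_comp single_valued_comp : kj.

Section FinitenessSubstitution.
Variables (T : topos) (V W : T) (s : V ~> W).
Implicit Types (S Q X Y : T).

Lemma is_function_comp X Y (A : W ~> pow X) (B : W ~> pow Y)
    (f : W ~> pow (X × Y)) :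
  is_function A B f \o s = is_function (A \o s) (B \o s) (f \o s).
Proof. unfold is_function; natural. Qed.

Lemma subsemilattice_comp X (A : W ~> pow X) (F : W ~> pow (pow X)) :
  subsemilattice A F \o s = subsemilattice (A \o s) (F \o s).
Proof. unfold subsemilattice; natural. Qed.

Lemma strict_linear_order_comp X (A : W ~> pow X) (lt : W ~> pow (X × X)) :
  strict_linear_order A lt \o s = strict_linear_order (A \o s) (lt \o s).
Proof. unfold strict_linear_order; natural. Qed.

End FinitenessSubstitution.
#[local] Hint Rewrite is_function_comp subsemilattice_comp
  strict_linear_order_comp : kj.

Lemma K_comp (T : topos) (V W X : T) (s : V ~> W) (A : W ~> pow X) :
  K A \o s = K (A \o s).
Proof. unfold K; natural. Qed.
#[local] Hint Rewrite K_comp : kj.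

Lemma finite_cardinal_comp (T : topos) (V W X : T) (s : V ~> W)
    (A : W ~> pow X) (lt : W ~> pow (X × X)) :
  finite_cardinal A lt \o s = finite_cardinal (A \o s) (lt \o s).
Proof. unfold finite_cardinal, finite; natural. Qed.
#[local] Hint Rewrite finite_cardinal_comp : kj.

Section StructureSubstitution.
Variables (T : topos) (V W : T) (s : V ~> W) (S Q : T).
Variables (Sg : W ~> pow S) (ar : W ~> pow (S × Q)).

Lemma signature_comp (lt : W ~> pow (S × (Q × Q))) :
  signature Sg ar lt \o s = signature (Sg \o s) (ar \o s) (lt \o s).
Proof. unfold signature; natural. Qed.

Lemma structure_comp X (A : W ~> pow X) (I : W ~> pow (S × pow (Q × X))) :
  structure Sg ar A I \o s = structure (Sg \o s) (ar \o s) (A \o s) (I \o s).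
Proof. unfold structure; natural. Qed.

Variables (X Y : T).
Variables (A : W ~> pow X) (I : W ~> pow (S × pow (Q × X))).
Variables (B : W ~> pow Y) (J : W ~> pow (S × pow (Q × Y))).

Lemma preserves_comp (f : W ~> pow (X × Y)) :
  preserves Sg ar A I B J f \o s =
  preserves (Sg \o s) (ar \o s) (A \o s) (I \o s) (B \o s) (J \o s) (f \o s).
Proof. unfold preserves; natural. Qed.

End StructureSubstitution.
#[local] Hint Rewrite signature_comp structure_comp preserves_comp : kj.

Section HomomorphismSubstitution.
Variables (T : topos) (V W : T) (s : V ~> W) (S Q : T).
Variables (Sg : W ~> pow S) (ar : W ~> pow (S × Q)).
Variables (X Y : T).
Variables (A : W ~> pow X) (I : W ~> pow (S × pow (Q × X))).
Variables (B : W ~> pow Y) (J : W ~> pow (S × pow (Q × Y))).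

Lemma homomorphism_comp (f : W ~> pow (X × Y)) :
  homomorphism Sg ar A I B J f \o s =
  homomorphism (Sg \o s) (ar \o s) (A \o s) (I \o s) (B \o s) (J \o s) (f \o s).
Proof. unfold homomorphism; natural. Qed.

Lemma finitary_homomorphism_comp (f : W ~> pow (X × Y)) :
  finitary_homomorphism Sg ar A I B J f \o s =
  finitary_homomorphism (Sg \o s) (ar \o s) (A \o s) (I \o s) (B \o s) (J \o s)
    (f \o s).
Proof.
unfold finitary_homomorphism, relational_homomorphism; natural.
Qed.

End HomomorphismSubstitution.
#[local] Hint Rewrite homomorphism_comp finitary_homomorphism_comp : kj.

Lemma finitary_homs_comp (T : topos) (V W : T) (s : V ~> W) (S Q X Y : T)
  (Sg : W ~> pow S) (ar : W ~> pow (S × Q))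
 (A : W ~> pow X) (I : W ~> pow (S × pow (Q × X)))
 (B : W ~> pow Y) (J : W ~> pow (S × pow (Q × Y))) :
  finitary_homs Sg ar A I B J \o s =
  finitary_homs (Sg \o s) (ar \o s) (A \o s) (I \o s) (B \o s) (J \o s).
Proof. unfold finitary_homs; natural. Qed.

Lemma jointly_total_comp (T : topos) (V W X Y : T) (s : V ~> W)
    (A : W ~> pow X) (H : W ~> pow (pow (X × Y))) :
  jointly_total A H \o s = jointly_total (A \o s) (H \o s).
Proof. unfold jointly_total; natural. Qed.
#[local] Hint Rewrite finitary_homs_comp jointly_total_comp : kj.

Section BooleanAlgebraSubstitution.
Variables (T : topos) (V W X : T) (s : V ~> W).
Variables (B : W ~> pow X).
Variables (e : W ~> X) (m : W ~> pow (X × X × X)) (n : W ~> pow (X × X)).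

Lemma ba_le_comp : ba_le m \o s = ba_le (m \o s).
Proof. unfold ba_le; natural. Qed.

Lemma ba_join_comp : ba_join m n \o s = ba_join (m \o s) (n \o s).
Proof. unfold ba_join; natural. Qed.
Hint Rewrite ba_le_comp ba_join_comp : kj.

Lemma boolean_algebra_comp :
  boolean_algebra B e m n \o s =
  boolean_algebra (B \o s) (e \o s) (m \o s) (n \o s).
Proof.
unfold boolean_algebra, algebra, ba_order, ba_meets, ba_involution,
  ba_complement, ba_distributive; natural.
Qed.

Lemma nontrivial_comp : nontrivial e n \o s = nontrivial (e \o s) (n \o s).
Proof. unfold nontrivial; natural. Qed.

End BooleanAlgebraSubstitution.
#[local] Hint Rewrite ba_le_comp ba_join_comp boolean_algebra_comp nontrivial_comp : kj.

Lemma meet2_comp (T : topos) (V W two : T) (s : V ~> W) (i0 i1 : one ~> two) :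
  meet2 W i0 i1 \o s = meet2 V i0 i1.
Proof. unfold meet2; natural. Qed.

Lemma not2_comp (T : topos) (V W two : T) (s : V ~> W) (i0 i1 : one ~> two) :
  not2 W i0 i1 \o s = not2 V i0 i1.
Proof. unfold not2; natural. Qed.
#[local] Hint Rewrite meet2_comp not2_comp : kj.

Lemma ba_homomorphism_comp (T : topos) (V W X Y : T) (s : V ~> W)
    (B : W ~> pow X) (e : W ~> X) (m : W ~> pow (X × X × X)) (n : W ~> pow (X × X))
    (B' : W ~> pow Y) (e' : W ~> Y) (m' : W ~> pow (Y × Y × Y))
    (n' : W ~> pow (Y × Y)) (h : W ~> pow (X × Y)) :
  ba_homomorphism B e m n B' e' m' n' h \o s =
  ba_homomorphism (B \o s) (e \o s) (m \o s) (n \o s)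
    (B' \o s) (e' \o s) (m' \o s) (n' \o s) (h \o s).
Proof. unfold ba_homomorphism; natural. Qed.
#[local] Hint Rewrite ba_homomorphism_comp : kj.

(** * Sets, functions and finiteness *)

Lemma eq_elim (T : topos) (W A : T) (a b : W ~> A) : tru (eq_ a b) -> a = b.
Proof. apply tru_eq. Qed.

Lemma and_elim (T : topos) (W : T) (p q : W ~> Omega) :
  tru (and_ p q) -> tru p /\ tru q.
Proof. apply tru_and. Qed.

Lemma under_pairing (T : topos) (U V W X : T) (s : V ~> W) (f : U ~> V)
    (a : U ~> X) :
  under s \o pairing f a = pairing (s \o f) a.
Proof.
unfold under; now rewrite pairing_comp, comp_pi1_pairing, pi2_pairing.
Qed.

(* Rules that leave the substitution suspended, so that it is pushed
   through the body of nested quantifiers only once. *)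
Lemma all_elim_at (T : topos) (V W X : T) (phi : W × X ~> X -> W × X ~> Omega)
    (s : V ~> W) (a : V ~> X) :
  tru (all_ phi \o s) -> tru (phi pi2 \o pairing s a).
Proof.
rewrite allE, allT_comp; intros H; apply (all_elim a) in H.
revert H.
now rewrite <- comp_assoc, under_pairing, comp_idr.
Qed.

Lemma all_in_elim_at (T : topos) (V W X : T) (S : W ~> pow X)
    (phi : W × X ~> X -> W × X ~> Omega) (s : V ~> W) (a : V ~> X) :
  tru (all_in_ S phi \o s) -> tru (a ∈ (S \o s)) ->
  tru (phi pi2 \o pairing s a).
Proof.
unfold all_in_; intros H Ha; apply (all_elim_at a) in H.
cbv beta in H; rewrite imp_comp in H; apply (imp_elim H).
push; exact Ha.
Qed.

Lemma ex_elim_at (T : topos) (V W X : T)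
    (phi : W × Omega × X ~> X -> W × Omega × X ~> Omega)
    (s : V ~> W) (q : V ~> Omega) :
  tru (ex_ phi \o s) ->
  (forall U (f : U ~> V) (a : U ~> X),
     tru (phi pi2 \o pairing (pairing (s \o f) (q \o f)) a) -> tru (q \o f)) ->
  tru q.
Proof.
rewrite exE, exT_comp; intros H K; apply (ex_elim H); intros U f a L.
apply (K U f a); revert L.
now rewrite <- (comp_assoc (phi pi2)), !under_pairing.
Qed.

Lemma ex_intro_at (T : topos) (V W X : T)
    (phi : W × Omega × X ~> X -> W × Omega × X ~> Omega)
    (s : V ~> W) (a : V ~> X) :
  (forall U (f : U ~> V) (t : U ~> Omega),
     tru (phi pi2 \o pairing (pairing (s \o f) t) (a \o f))) ->
  tru (ex_ phi \o s).
Proof.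
rewrite exE, exT_comp; intros H; apply (ex_intro (a := a)); intros U f t.
rewrite <- (comp_assoc (phi pi2)), !under_pairing; apply H.
Qed.

Lemma all_intro_at (T : topos) (V W X : T) (phi : W × X ~> X -> W × X ~> Omega)
    (s : V ~> W) :
  (forall U (f : U ~> V) (a : U ~> X), tru (phi pi2 \o pairing (s \o f) a)) ->
  tru (all_ phi \o s).
Proof.
intros H; rewrite allE, allT_comp; apply tru_all; intros U f a.
rewrite <- comp_assoc, under_pairing; apply H.
Qed.

Lemma imp_intro_at (T : topos) (V W : T) (p q : W ~> Omega) (s : V ~> W) :
  (forall U (f : U ~> V), tru (p \o (s \o f)) -> tru (q \o (s \o f))) ->
  tru (imp_ p q \o s).
Proof.
intros H; rewrite imp_comp; apply tru_imp; intros U f.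
rewrite <- !comp_assoc; apply H.
Qed.

(** The delayed rules expect a formula under a substitution; [kat] supplies the identity when none
    is there. *)
Ltac kat H :=
  lazymatch type of H with
  | tru (_ \o _) => idtac
  | tru ?p => rewrite <- (comp_idr p) in H
  end.
Ltac kinst H a := kat H; apply (all_elim_at a) in H; cbv beta in H.
Ltac kspec H Ha :=
  kat H;
  lazymatch type of Ha with
  | tru (mem ?a _) =>
      apply (all_in_elim_at (a := a)) in H; [cbv beta in H|push; exact Ha]
  end.

(* [shift f] moves the goal and all hypotheses from stage [W] to [V] along
   [f : V ~> W], and then renames each restricted variable [x \o f] to [x]. *)
Ltac shift f :=
  match type of f with Hom ?V ?W =>
    repeat match goal with
      H : @tru _ W _ |- _ => apply (tru_sub f) in H; push_in H
    end;
    push;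
    repeat match goal with x : term W _ |- _ => unfold term in x end;
    repeat match goal with
      x : Hom W _ |- _ =>
        let x' := fresh x in
        set (x' := x \o f) in *; clearbody x'; clear x; rename x' into x
    end;
    clear f; try clear W
  end.

Ltac kall x := push; apply tru_all; let f := fresh in intros ? f x; shift f.
Ltac kimp H :=
  push; apply tru_imp; let f := fresh in intros ? f H; push_in H; shift f.
Ltac kdelay x f := apply all_intro_at; intros ? f x; cbv beta.
Ltac kall3 x y z :=
  rewrite <- comp_idr;
  let f := fresh in kdelay x f; let g := fresh in kdelay y g;
  let k := fresh in kdelay z k;
  shift f; shift g; shift k.
Ltac kin x H := kall x; kimp H.
Ltac knot H :=
  push; apply tru_not; let f := fresh in intros ? f H; push_in H; shift f.
Ltac kexists a :=
  push; apply (ex_intro (a := a)); let f := fresh in let t := fresh in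
  intros ? f t; shift f; clear t.
Ltac kor E :=
  push_in E; let f := fresh in
  apply (or_elim E); clear E; intros ? f E; push_in E; shift f.
Ltac keq H :=
  apply eq_elim in H;
  match type of H with ?a = ?b => first [subst a | subst b | idtac] end.
Ltac kand := push; apply tru_and.
Ltac kand_in H H' := push_in H; apply and_elim in H; destruct H as [H H'].

Section Sets.
Variables (T : topos) (W : T).
Implicit Types (X Y : T).

Lemma mem_full X (x : W ~> X) : mem x full = top_ W.
Proof. unfold full; now push. Qed.

Lemma mem_empty X (x : W ~> X) : mem x empty = bot_ W.
Proof. unfold empty; now push. Qed.

Lemma mem_single X (x a : W ~> X) : mem x (single a) = eq_ x a.
Proof. unfold single; now push. Qed.

Lemma mem_union X (A B : W ~> pow X) (x : W ~> X) :
  mem x (union A B) = or_ (mem x A) (mem x B).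
Proof. unfold union; now push. Qed.

Lemma mem_cart X Y (A : W ~> pow X) (B : W ~> pow Y) (p : W ~> X × Y) :
  mem p (cart A B) = and_ (mem (tfst p) A) (mem (tsnd p) B).
Proof. unfold cart; now push. Qed.

Lemma mem_fiber X Y (f : W ~> pow (X × Y)) (x : W ~> X) (y : W ~> Y) :
  mem y (fiber f x) = mem (tpair x y) f.
Proof. unfold fiber; now push. Qed.

End Sets.
#[local] Hint Rewrite mem_full mem_empty mem_single mem_union mem_cart mem_fiber
  : kj.

Lemma subset_elim (T : topos) (W X : T) (A B : W ~> pow X) (x : W ~> X) :
  tru (subset A B) -> tru (x ∈ A) -> tru (x ∈ B).
Proof.
unfold subset; push; intros H; apply (all_elim x) in H; push_in H.
apply (imp_elim H).
Qed.

Lemma empty_subset (T : topos) (W X : T) (A : W ~> pow X) :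
  tru (subset empty A).
Proof. unfold subset; kin x Hx; now apply bot_elim. Qed.

Lemma single_subset (T : topos) (W X : T) (A : W ~> pow X) (a : W ~> X) :
  tru (a ∈ A) -> tru (subset (single a) A).
Proof. intros Ha; unfold subset; kin x Hx; keq Hx; exact Ha. Qed.

Lemma union_subset (T : topos) (W X : T) (A B C : W ~> pow X) :
  tru (subset A C) -> tru (subset B C) -> tru (subset (union A B) C).
Proof.
intros HA HB; unfold subset; kin x Hx; kor Hx.
- exact (subset_elim HA Hx).
- exact (subset_elim HB Hx).
Qed.

Section Functions.
Variables (T : topos) (W X Y : T).

Lemma dom_intro (f : W ~> pow (X × Y)) x y :
  tru (⟨x, y⟩ ∈ f) -> tru (x ∈ dom f).
Proof. intros H; unfold dom; kexists y; exact H. Qed.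

Lemma dom_elim (f : W ~> pow (X × Y)) x q :
  tru (x ∈ dom f) ->
  (forall V (s : V ~> W) y, tru (⟨x \o s, y⟩ ∈ (f \o s)) -> tru (q \o s)) ->
  tru q.
Proof.
intros H K; unfold dom in H; push_in H; apply (ex_elim H).
intros V s y E; push_in E; exact (K V s y E).
Qed.

Lemma single_valued_elim (f : W ~> pow (X × Y)) x y y' :
  tru (single_valued f) -> tru (⟨x, y⟩ ∈ f) -> tru (⟨x, y'⟩ ∈ f) -> y = y'.
Proof.
unfold single_valued; push; intros H Hy Hy'.
apply (all_elim x) in H; push_in H; apply (all_elim y) in H; push_in H.
apply (all_elim y') in H; push_in H.
now apply eq_elim, (imp_elim H), tru_and.
Qed.

Variables (A : W ~> pow X) (B : W ~> pow Y) (f : W ~> pow (X × Y)).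
Hypothesis Hf : tru (is_function A B f).

Lemma fun_dom x y : tru (⟨x, y⟩ ∈ f) -> tru (x ∈ A).
Proof.
unfold is_function in Hf; apply tru_and in Hf; destruct Hf as [H _].
intros K; apply (subset_elim H) in K; kand_in K K'; exact K.
Qed.

Lemma fun_cod x y : tru (⟨x, y⟩ ∈ f) -> tru (y ∈ B).
Proof.
unfold is_function in Hf; apply tru_and in Hf; destruct Hf as [H _].
intros K; apply (subset_elim H) in K; kand_in K K'; exact K'.
Qed.

Lemma fun_uniq x y y' : tru (⟨x, y⟩ ∈ f) -> tru (⟨x, y'⟩ ∈ f) -> y = y'.
Proof.
unfold is_function in Hf; apply tru_and in Hf; destruct Hf as [_ H].
kand_in H H'; now apply single_valued_elim.
Qed.

Lemma fun_total x : tru (x ∈ A) -> tru (x ∈ dom f).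
Proof.
unfold is_function in Hf; apply tru_and in Hf; destruct Hf as [_ H].
kand_in H H'; now apply subset_elim.
Qed.

End Functions.

(** A value of a total relation is available only at a later stage, so [kval] works towards a forced
    goal and carries all hypotheses to that stage. *)
Ltac kval E y H :=
  let f := fresh in
  apply (dom_elim E); clear E; intros ? f y H; push_in H; shift f.

Lemma K_elim (T : topos) (W X : T) (A S : W ~> pow X) F :
  tru (S ∈ K A) -> tru (subsemilattice A F) -> tru (S ∈ F).
Proof.
unfold K; push; intros H; apply (all_elim F) in H; push_in H.
apply (imp_elim H).
Qed.

Section Finiteness.
Variables (T : topos) (W X : T).
Implicit Types (A S : W ~> pow X).

Lemma K_intro A S :
  (forall V (s : V ~> W) F,
     tru (subsemilattice (A \o s) F) -> tru ((S \o s) ∈ F)) ->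
  tru (S ∈ K A).
Proof.
intros H; unfold K; push; apply tru_all; intros V s F; push.
apply tru_imp; intros U s' HF; push_in HF; push.
specialize (H U (s \o s') (F \o s')); push_in H; now apply H.
Qed.

Lemma K_empty A : tru (empty ∈ K A).
Proof.
apply K_intro; intros V s F HF; push; unfold subsemilattice in HF.
apply tru_and in HF; destruct HF as [_ HF]; now apply tru_and in HF.
Qed.

Lemma K_single A x : tru (x ∈ A) -> tru (single x ∈ K A).
Proof.
intros Hx; apply K_intro; intros V s F HF; push; unfold subsemilattice in HF.
apply (tru_sub s) in Hx; push_in Hx; push_in HF.
kand_in HF HF1; kand_in HF1 HF2; kand_in HF2 HF3.
apply (all_elim (x \o s)) in HF2; push_in HF2; now apply (imp_elim HF2).
Qed.

Lemma K_union A S S' :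
  tru (S ∈ K A) -> tru (S' ∈ K A) -> tru (union S S' ∈ K A).
Proof.
intros HS HS'; apply K_intro; intros V s F HF; push.
apply (tru_sub s) in HS, HS'; push_in HS; push_in HS'.
pose proof (K_elim HS HF) as H; pose proof (K_elim HS' HF) as H'.
unfold subsemilattice in HF; push_in HF.
kand_in HF HF1; kand_in HF1 HF2; kand_in HF2 HF3.
apply (all_elim (S \o s)) in HF3; push_in HF3; pose proof (imp_elim HF3 H) as L.
apply (all_elim (S' \o s)) in L; push_in L; now apply (imp_elim L).
Qed.

Lemma K_subset A S : tru (S ∈ K A) -> tru (subset S A).
Proof.
intros H.
(* Induction over finite subsets: the property is turned into a family [F] and shown to be a
   subsemilattice. *)
enough (L : tru (S ∈ ({{ S : pow X | subset S ↑A }} : W ~> pow (pow X))))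
  by (push_in L; exact L).
apply (K_elim H); clear H; unfold subsemilattice.
repeat (kand; split).
- kin R HR; exact HR.
- apply empty_subset.
- kin x Hx; now apply single_subset.
- kin R HR; kin R' HR'; now apply union_subset.
Qed.

End Finiteness.

(** * Finite cardinals and quadruples *)

Lemma excluded_middle (T : topos) (hT : boolean_topos T) (W : T)
    (p : W ~> Omega) : tru (p ∨ ¬ p).
Proof.
assert (H := tru_sub (@bang T W) hT); push_in H.
apply (all_elim p) in H; push_in H; exact H.
Qed.

Section Orders.
Variables (T : topos).
Implicit Types (W X Y : T).

Lemma slo_irrefl W X (A : W ~> pow X) lt x (q : W ~> Omega) :
  tru (strict_linear_order A lt) -> tru (⟨x, x⟩ ∈ lt) -> tru q.
Proof.
unfold strict_linear_order; intros H; kand_in H H1; kand_in H1 H2; clear H H2.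
apply (all_elim x) in H1; push_in H1; apply (not_elim _ H1).
Qed.

Lemma slo_trans W X (A : W ~> pow X) lt x y z :
  tru (strict_linear_order A lt) ->
  tru (⟨x, y⟩ ∈ lt) -> tru (⟨y, z⟩ ∈ lt) -> tru (⟨x, z⟩ ∈ lt).
Proof.
unfold strict_linear_order; intros H.
kand_in H H1; kand_in H1 H2; kand_in H2 H3; clear H H1 H3.
intros Hx Hy.
apply (all_elim x) in H2; push_in H2; apply (all_elim y) in H2; push_in H2.
apply (all_elim z) in H2; push_in H2.
now apply (imp_elim H2), tru_and.
Qed.

Lemma slo_total W X (A : W ~> pow X) lt x y :
  tru (strict_linear_order A lt) -> tru (x ∈ A) -> tru (y ∈ A) ->
  tru (⟨x, y⟩ ∈ lt ∨ x ≡ y ∨ ⟨y, x⟩ ∈ lt).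
Proof.
unfold strict_linear_order; intros H.
kand_in H H1; kand_in H1 H2; kand_in H2 H3; clear H H1 H2.
intros Hx Hy.
apply (all_elim x) in H3; push_in H3; pose proof (imp_elim H3 Hx) as L.
apply (all_elim y) in L; push_in L; now apply (imp_elim L).
Qed.

(** The lexicographic order, which makes [two × two] a finite cardinal and hence a legitimate
    arity. *)
Definition lex W X Y (lt : W ~> pow (X × X)) (lt' : W ~> pow (Y × Y))
  : W ~> pow ((X × Y) × (X × Y)) :=
  {{ p : (X × Y) × (X × Y) |
     ⟨tfst (tfst p), tfst (tsnd p)⟩ ∈ ↑lt ∨
     (tfst (tfst p) ≡ tfst (tsnd p) ∧
      ⟨tsnd (tfst p), tsnd (tsnd p)⟩ ∈ ↑lt') }}.

Lemma lex_comp V W X Y (s : V ~> W) (lt : W ~> pow (X × X))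
    (lt' : W ~> pow (Y × Y)) :
  lex lt lt' \o s = lex (lt \o s) (lt' \o s).
Proof. unfold lex; now push. Qed.

Lemma mem_lex W X Y (lt : W ~> pow (X × X)) (lt' : W ~> pow (Y × Y))
    (x x' : W ~> X) (y y' : W ~> Y) :
  mem ⟨⟨x, y⟩, ⟨x', y'⟩⟩ (lex lt lt') =
  (⟨x, x'⟩ ∈ lt ∨ (x ≡ x' ∧ ⟨y, y'⟩ ∈ lt'))%topos.
Proof. unfold lex; now push. Qed.

End Orders.
#[local] Hint Rewrite lex_comp mem_lex : kj.

Ltac kpair p x y :=
  generalize (eq_sym (tpair_eta p)); generalize (tfst p) (tsnd p);
  let E := fresh in intros x y E; subst p.

Lemma lex_strict_linear_order (T : topos) (W X Y : T)
    (lt : W ~> pow (X × X)) (lt' : W ~> pow (Y × Y)) :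
  tru (strict_linear_order full lt) -> tru (strict_linear_order full lt') ->
  tru (strict_linear_order full (lex lt lt')).
Proof.
intros H H'; unfold strict_linear_order at 1; repeat (kand; split).
- unfold subset; kin p Hp; kand; split; apply tru_top.
- kall p; kpair p x y; push; knot L; kor L.
  + exact (slo_irrefl _ H L).
  + kand_in L L'; exact (slo_irrefl _ H' L').
- kall p; kall p'; kall p''; kpair p x y; kpair p' x' y'; kpair p'' x'' y''.
  push; kimp L; kand_in L L'; kor L; kor L'.
  + apply or_introl; exact (slo_trans H L L').
  + kand_in L' M; keq L'; now apply or_introl.
  + kand_in L M; keq L; now apply or_introl.
  + kand_in L M; keq L; kand_in L' M'; keq L'.
    apply or_intror; kand; split; [now apply tru_eq|exact (slo_trans H' M M')].
- kin p Hp; kin p' Hp'; kpair p x y; kpair p' x' y'; push.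
  assert (L := slo_total (x := x) (y := x') H).
  push_in L; specialize (L (tru_top _) (tru_top _)); kor L; [|kor L].
  + now apply or_introl, or_introl.
  + keq L.
    assert (L := slo_total (x := y) (y := y') H').
    push_in L; specialize (L (tru_top _) (tru_top _)); kor L; [|kor L].
    * apply or_introl, or_intror; kand; split; [now apply tru_eq|exact L].
    * keq L; now apply or_intror, or_introl, tru_eq.
    * apply or_intror, or_intror, or_intror; kand.
      split; [now apply tru_eq|exact L].
  + now apply or_intror, or_intror, or_introl.
Qed.

(** * The coproduct of two points: case analysis and disjointness *)

Section Two.
Variables (T : topos) (two : T) (i0 i1 : one ~> two).
Hypothesis cop : is_coproduct i0 i1.

(** Membership in one of the two summands is a map from [two] to [Omega]. It agrees with truth along
    both injections, so it is truth by the uniqueness part of the coproduct property. *)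
Lemma two_cases W (y : W ~> two) (q : W ~> Omega) :
  (forall V (s : V ~> W), y \o s = const V i0 -> tru (q \o s)) ->
  (forall V (s : V ~> W), y \o s = const V i1 -> tru (q \o s)) -> tru q.
Proof.
intros H0 H1.
set (phi := (idm ≡ const two i0 ∨ idm ≡ const two i1) : two ~> Omega).
assert (E : phi = top_ two).
{ destruct (cop (top_ one) (top_ one)) as [h [_ uniq]].
  transitivity h; [symmetry|]; apply uniq; split; try apply top_comp.
  - unfold phi; push; apply or_introl, tru_eq.
    unfold const; rewrite <- (bang_uniq idm); now push.
  - unfold phi; push; apply or_intror, tru_eq.
    unfold const; rewrite <- (bang_uniq idm); now push. }
assert (L : tru (phi \o y)) by (rewrite E; apply top_comp).
unfold phi in L; push_in L.
apply (or_elim L); intros V s K; push_in K; apply eq_elim in K; auto.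
Qed.

(** The map [h] from [two] to [Omega] with values falsity and truth separates the injections: if
    they agree at stage [W], falsity is forced there. *)
Lemma two_disjoint W (q : W ~> Omega) : const W i0 = const W i1 -> tru q.
Proof.
intros E; apply bot_elim.
destruct (cop (bot_ one) (top_ one)) as [h [[h0 h1] _]].
apply (f_equal (comp h)) in E; unfold const in E.
rewrite !comp_assoc, h0, h1, bot_comp in E; rewrite E; apply top_comp.
Qed.

End Two.

Ltac kcase cop y :=
  let f := fresh in let E := fresh in
  apply (two_cases cop (y := y)); intros ? f E; shift f; subst y.

Section FiniteCardinals.
Variables (T : topos) (two : T) (i0 i1 : one ~> two).
Hypothesis cop : is_coproduct i0 i1.

Definition lt2 (W : T) : W ~> pow (two × two) :=
  single ⟨const W i0, const W i1⟩.

Lemma lt2_comp V W (s : V ~> W) : lt2 W \o s = lt2 V.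
Proof. unfold lt2; now push. Qed.
Hint Rewrite lt2_comp : kj.

Lemma lt2_elim W (x y : W ~> two) :
  tru (⟨x, y⟩ ∈ lt2 W) -> x = const W i0 /\ y = const W i1.
Proof.
unfold lt2; push; intros H; apply eq_elim in H; now apply tpair_inj.
Qed.

Lemma lt2_intro W : tru (⟨const W i0, const W i1⟩ ∈ lt2 W).
Proof. unfold lt2; push; now apply tru_eq. Qed.

Lemma lt2_strict_linear_order W : tru (strict_linear_order full (lt2 W)).
Proof.
unfold strict_linear_order; repeat (kand; split).
- unfold subset; kin p Hp; kand; split; apply tru_top.
- kall x; knot H; apply lt2_elim in H; destruct H as [-> E].
  exact (two_disjoint cop _ E).
- kall x; kall y; kall z; kimp H; kand_in H H'.
  apply lt2_elim in H, H'; destruct H as [_ ->], H' as [E _].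
  now apply (two_disjoint cop).
- kin x Hx; kin y Hy; kcase cop x; kcase cop y.
  + now apply or_intror, or_introl, tru_eq.
  + apply or_introl, lt2_intro.
  + apply or_intror, or_intror, lt2_intro.
  + now apply or_intror, or_introl, tru_eq.
Qed.

Lemma full_two W : full = union (single (const W i0)) (single (const W i1)).
Proof.
apply pow_ext; intros V s x; push; split; [intros _|intros _; apply tru_top].
clear s; kcase cop x; [apply or_introl|apply or_intror]; now apply tru_eq.
Qed.

Lemma full_two_square W :
  full = union
    (union (single ⟨const W i0, const W i0⟩) (single ⟨const W i0, const W i1⟩))
    (union (single ⟨const W i1, const W i0⟩) (single ⟨const W i1, const W i1⟩)).
Proof.
apply pow_ext; intros V s p; push; split; [intros _|intros _; apply tru_top].
clear s; kpair p x y; kcase cop x; kcase cop y.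
- now apply or_introl, or_introl, tru_eq.
- now apply or_introl, or_intror, tru_eq.
- now apply or_intror, or_introl, tru_eq.
- now apply or_intror, or_intror, tru_eq.
Qed.

Lemma finite_cardinal_two W : tru (finite_cardinal full (lt2 W)).
Proof.
unfold finite_cardinal; apply tru_and; split; [|apply lt2_strict_linear_order].
(* Only the set itself is enumerated; the bound inside [K] stays [full]. *)
unfold finite; rewrite full_two at 1.
apply K_union; apply K_single; push; apply tru_top.
Qed.

Lemma finite_cardinal_two_square W :
  tru (finite_cardinal full (lex (lt2 W) (lt2 W))).
Proof.
unfold finite_cardinal; apply tru_and; split.
- unfold finite; rewrite full_two_square at 1.
  repeat apply K_union; apply K_single; push; apply tru_top.
- apply lex_strict_linear_order; apply lt2_strict_linear_order.
Qed.

End FiniteCardinals.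
#[local] Hint Rewrite lt2_comp : kj.

Section Quadruples.
Variables (T : topos) (two : T) (i0 i1 : one ~> two).
Hypothesis cop : is_coproduct i0 i1.
Implicit Types (V W X : T).

(** Slots 00, 01, 10, 11 of the tuple. In [op_graph] they hold the two arguments of the meet, its
    result, and the negation of the first argument. *)
Definition reads W X (t : W ~> pow ((two × two) × X)) (a b c d : W ~> X)
  : W ~> Omega :=
  ((⟨⟨const W i0, const W i0⟩, a⟩ ∈ t ∧ ⟨⟨const W i0, const W i1⟩, b⟩ ∈ t) ∧
   (⟨⟨const W i1, const W i0⟩, c⟩ ∈ t ∧ ⟨⟨const W i1, const W i1⟩, d⟩ ∈ t)).

Lemma reads_comp V W X (s : V ~> W) (t : W ~> pow ((two × two) × X))
    (a b c d : W ~> X) :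
  reads t a b c d \o s = reads (t \o s) (a \o s) (b \o s) (c \o s) (d \o s).
Proof. unfold reads; now push. Qed.
Hint Rewrite reads_comp : kj.

Lemma tru_reads W X (t : W ~> pow ((two × two) × X)) (a b c d : W ~> X) :
  tru (reads t a b c d) <->
  (tru (⟨⟨const W i0, const W i0⟩, a⟩ ∈ t) /\
   tru (⟨⟨const W i0, const W i1⟩, b⟩ ∈ t)) /\
  (tru (⟨⟨const W i1, const W i0⟩, c⟩ ∈ t) /\
   tru (⟨⟨const W i1, const W i1⟩, d⟩ ∈ t)).
Proof. unfold reads; now rewrite !tru_and. Qed.

Lemma reads_total W X (A : W ~> pow X) (t : W ~> pow ((two × two) × X))
    (q : W ~> Omega) :
  tru (is_function full A t) ->
  (forall V (s : V ~> W) a b c d,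
     tru (reads (t \o s) a b c d) -> tru (q \o s)) -> tru q.
Proof.
intros Ht.
assert (D : forall i, tru (i ∈ dom t))
  by (intros i; apply (fun_total Ht); push; apply tru_top).
intros K.
apply (dom_elim (D ⟨const W i0, const W i0⟩)); intros V1 s1 a Ha.
push_in Ha; assert (D1 := tru_sub s1 (D ⟨const W i0, const W i1⟩)); push_in D1.
apply (dom_elim D1); intros V2 s2 b Hb; push_in Hb.
assert (D2 := tru_sub (s1 \o s2) (D ⟨const W i1, const W i0⟩)); push_in D2.
apply (dom_elim D2); intros V3 s3 c Hc; push_in Hc.
assert (D3 := tru_sub (s1 \o s2 \o s3) (D ⟨const W i1, const W i1⟩)); push_in D3.
apply (dom_elim D3); intros V4 s4 d Hd; push_in Hd.
(* The four entries are found at successive stages; the earlier ones are restricted to the last. *)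
specialize (K _ (s1 \o s2 \o s3 \o s4) (a \o s2 \o s3 \o s4)
  (b \o s3 \o s4) (c \o s4) d).
push; push_in K; apply K, tru_reads.
apply (tru_sub (s2 \o s3 \o s4)) in Ha; push_in Ha.
apply (tru_sub (s3 \o s4)) in Hb; push_in Hb.
apply (tru_sub s4) in Hc; push_in Hc; auto.
Qed.

Lemma reads_uniq W X (A : W ~> pow X) (t : W ~> pow ((two × two) × X))
    (a b c d a' b' c' d' : W ~> X) :
  tru (is_function full A t) ->
  tru (reads t a b c d) -> tru (reads t a' b' c' d') ->
  (a = a' /\ b = b') /\ (c = c' /\ d = d').
Proof.
rewrite !tru_reads.
intros Ht [[Ha Hb] [Hc Hd]] [[Ha' Hb'] [Hc' Hd']].
repeat split.
- exact (fun_uniq Ht Ha Ha').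
- exact (fun_uniq Ht Hb Hb').
- exact (fun_uniq Ht Hc Hc').
- exact (fun_uniq Ht Hd Hd').
Qed.

Definition quadruple W X (a b c d : W ~> X) : W ~> pow ((two × two) × X) :=
  union
    (union (single ⟨⟨const W i0, const W i0⟩, a⟩)
           (single ⟨⟨const W i0, const W i1⟩, b⟩))
    (union (single ⟨⟨const W i1, const W i0⟩, c⟩)
           (single ⟨⟨const W i1, const W i1⟩, d⟩)).

Lemma quadruple_comp V W X (s : V ~> W) (a b c d : W ~> X) :
  quadruple a b c d \o s = quadruple (a \o s) (b \o s) (c \o s) (d \o s).
Proof. unfold quadruple; now push. Qed.
Hint Rewrite quadruple_comp : kj.

Lemma reads_quadruple W X (a b c d : W ~> X) :
  tru (reads (quadruple a b c d) a b c d).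
Proof.
apply tru_reads; unfold quadruple; push; repeat split.
- now apply or_introl, or_introl, tru_eq.
- now apply or_introl, or_intror, tru_eq.
- now apply or_intror, or_introl, tru_eq.
- now apply or_intror, or_intror, tru_eq.
Qed.

Lemma quadruple_function W X (A : W ~> pow X) (a b c d : W ~> X) :
  tru (a ∈ A) -> tru (b ∈ A) -> tru (c ∈ A) -> tru (d ∈ A) ->
  tru (is_function full A (quadruple a b c d)).
Proof.
intros Ha Hb Hc Hd; unfold is_function; repeat (kand; split).
- unfold subset; kin p Hp; kpair p i x; kand.
  split; [apply tru_top|push].
  unfold quadruple in Hp; push_in Hp; kor Hp; kor Hp; apply eq_elim in Hp;
    apply tpair_inj in Hp; destruct Hp as [_ ->]; assumption.
- unfold single_valued; kall3 i x y; kimp H; kand_in H H'.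
  unfold quadruple in H, H'; push_in H; push_in H'.
  (* Sixteen pairs of clauses: equal slots give equal values, and distinct slots differ in a
     coordinate, against [two_disjoint]. *)
  kor H; kor H; kor H'; kor H'; apply eq_elim in H, H';
    apply tpair_inj in H, H'; destruct H as [-> ->], H' as [E ->];
    apply tpair_inj in E; destruct E as [E E'];
    first [ now apply tru_eq
          | now apply (two_disjoint cop);
            (apply E || apply E' ||
             (symmetry; apply E) || (symmetry; apply E')) ].
- assert (R := reads_quadruple a b c d); unfold subset; kin i Hi.
  apply tru_reads in R; destruct R as [[R1 R2] [R3 R4]].
  kpair i x y; kcase cop x; kcase cop y; eapply dom_intro; eassumption.
Qed.

(** Universal in the entries: a functional tuple has unique ones, so this says the same as the
    existential form, but using it needs no change of stage. *)
Definition preserves_ops W X (m : W ~> pow (X × X × X)) (n : W ~> pow (X × X))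
    (t : W ~> pow ((two × two) × X)) : W ~> Omega :=
  ∀ a : X, ∀ b : X, ∀ c : X, ∀ d : X,
    reads ↑t ↑a ↑b ↑c d ⇒ ⟨⟨↑a, ↑b⟩, ↑c⟩ ∈ ↑m ∧ ⟨↑a, d⟩ ∈ ↑n.

Lemma preserves_ops_comp V W X (s : V ~> W) (m : W ~> pow (X × X × X))
    (n : W ~> pow (X × X)) (t : W ~> pow ((two × two) × X)) :
  preserves_ops m n t \o s = preserves_ops (m \o s) (n \o s) (t \o s).
Proof. unfold preserves_ops; natural. Qed.
Hint Rewrite preserves_ops_comp : kj.

(* The quaternary relation [a ∧ b = c] and [¬ a = d]: its homomorphisms are
   those of both operations. *)
Definition op_graph W X (A : W ~> pow X) (m : W ~> pow (X × X × X))
    (n : W ~> pow (X × X)) : W ~> pow (one × pow ((two × two) × X)) :=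
  {{ p : one × pow ((two × two) × X) |
     is_function full ↑A (tsnd p) ∧ preserves_ops ↑m ↑n (tsnd p) }}.

Lemma op_graph_comp V W X (s : V ~> W) (A : W ~> pow X)
    (m : W ~> pow (X × X × X)) (n : W ~> pow (X × X)) :
  op_graph A m n \o s = op_graph (A \o s) (m \o s) (n \o s).
Proof. unfold op_graph; natural. Qed.
Hint Rewrite op_graph_comp : kj.

Lemma mem_op_graph W X (A : W ~> pow X) m n r t :
  tru (⟨r, t⟩ ∈ op_graph A m n) <->
  tru (is_function full A t) /\ tru (preserves_ops m n t).
Proof. unfold op_graph; push; apply tru_and. Qed.

Lemma op_graph_elim W X (A : W ~> pow X) m n r t (a b c d : W ~> X) :
  tru (⟨r, t⟩ ∈ op_graph A m n) -> tru (reads t a b c d) ->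
  tru (⟨⟨a, b⟩, c⟩ ∈ m) /\ tru (⟨a, d⟩ ∈ n).
Proof.
rewrite mem_op_graph; intros [_ H] R; unfold preserves_ops in H.
kinst H a; kinst H b; kinst H c; kinst H d.
push_in H; now apply and_elim, (imp_elim H).
Qed.

Lemma op_graph_intro W X (A : W ~> pow X) m n r t (a b c d : W ~> X) :
  tru (is_function full A t) -> tru (reads t a b c d) ->
  tru (⟨⟨a, b⟩, c⟩ ∈ m) -> tru (⟨a, d⟩ ∈ n) -> tru (⟨r, t⟩ ∈ op_graph A m n).
Proof.
intros Ht R Hm Hn; apply mem_op_graph; split; [exact Ht|].
unfold preserves_ops; rewrite <- comp_idr.
kdelay a' f1; kdelay b' f2; kdelay c' f3; kdelay d' f4.
shift f1; shift f2; shift f3; shift f4; kimp R'.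
destruct (reads_uniq Ht R R') as [[-> ->] [-> ->]].
now apply tru_and.
Qed.

End Quadruples.
#[local] Hint Rewrite reads_comp quadruple_comp preserves_ops_comp
  op_graph_comp : kj.

(** * Boolean algebras *)

Section BooleanAlgebras.
Variable T : topos.
Implicit Types (V W X : T).

(** From here on [a ≤ b] is spelled [⟨⟨a, b⟩, a⟩ ∈ m], and [z] being 0 is spelled [⟨e, z⟩ ∈ n]. *)
Lemma mem_ba_le W X (m : W ~> pow (X × X × X)) (a b : W ~> X) :
  mem ⟨a, b⟩ (ba_le m) = mem ⟨⟨a, b⟩, a⟩ m.
Proof. unfold ba_le; now push. Qed.
Hint Rewrite mem_ba_le : kj.

Lemma ba_join_intro W X (m : W ~> pow (X × X × X)) (n : W ~> pow (X × X))
    (x y z a b c : W ~> X) :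
  tru (⟨x, a⟩ ∈ n) -> tru (⟨y, b⟩ ∈ n) -> tru (⟨⟨a, b⟩, c⟩ ∈ m) ->
  tru (⟨c, z⟩ ∈ n) -> tru (⟨⟨x, y⟩, z⟩ ∈ ba_join m n).
Proof.
intros Ha Hb Hc Hz; unfold ba_join; rewrite comprE, mem_compr; cbv beta.
apply (ex_intro_at (a := a)); intros V1 s1 t1.
apply (ex_intro_at (a := b \o s1)); intros V2 s2 t2.
apply (ex_intro_at (a := c \o s1 \o s2)); intros V3 s3 t3; cbv beta.
apply (tru_sub (s1 \o s2 \o s3)) in Ha, Hb, Hc, Hz.
push_in Ha; push_in Hb; push_in Hc; push_in Hz; push; rewrite !tru_and; auto.
Qed.

Lemma ba_join_elim W X (m : W ~> pow (X × X × X)) (n : W ~> pow (X × X))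
    (x y z : W ~> X) (q : W ~> Omega) :
  tru (⟨⟨x, y⟩, z⟩ ∈ ba_join m n) ->
  (forall V (s : V ~> W) (a b c : V ~> X),
     tru (⟨x \o s, a⟩ ∈ (n \o s)) -> tru (⟨y \o s, b⟩ ∈ (n \o s)) ->
     tru (⟨⟨a, b⟩, c⟩ ∈ (m \o s)) -> tru (⟨c, z \o s⟩ ∈ (n \o s)) ->
     tru (q \o s)) ->
  tru q.
Proof.
intros H K; unfold ba_join in H; rewrite comprE, mem_compr in H; cbv beta in H.
apply (ex_elim_at H); intros V1 s1 a H1; cbv beta in H1.
apply (ex_elim_at H1); intros V2 s2 b H2; cbv beta in H2.
apply (ex_elim_at H2); intros V3 s3 c H3; push_in H3.
rewrite !tru_and in H3; destruct H3 as [H3 [H4 [H5 H6]]].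
specialize (K _ (s1 \o s2 \o s3) (a \o s2 \o s3) (b \o s3) c).
push; push_in K; now apply K.
Qed.

Section Laws.
Variables (W X : T) (B : W ~> pow X) (e : W ~> X).
Variables (m : W ~> pow (X × X × X)) (n : W ~> pow (X × X)).
Hypothesis H : tru (boolean_algebra B e m n).

Lemma ba_top_mem : tru (e ∈ B).
Proof.
unfold boolean_algebra, algebra in H; apply and_elim in H.
destruct H as [L _]; now apply and_elim in L.
Qed.

Lemma ba_meet_function : tru (is_function (cart B B) B m).
Proof.
unfold boolean_algebra, algebra in H; apply and_elim in H.
destruct H as [L _]; apply and_elim in L; destruct L as [_ L].
now apply and_elim in L.
Qed.

Lemma ba_neg_function : tru (is_function B B n).
Proof.
unfold boolean_algebra, algebra in H; apply and_elim in H.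
destruct H as [L _]; apply and_elim in L; destruct L as [_ L].
now apply and_elim in L.
Qed.

Lemma ba_meet_mem a b c :
  tru (⟨⟨a, b⟩, c⟩ ∈ m) -> tru (a ∈ B) /\ tru (b ∈ B) /\ tru (c ∈ B).
Proof.
intros K; assert (L := fun_dom ba_meet_function K); push_in L; kand_in L L'.
now assert (M := fun_cod ba_meet_function K).
Qed.

Lemma ba_le_refl a : tru (a ∈ B) -> tru (⟨⟨a, a⟩, a⟩ ∈ m).
Proof.
intros Ha; unfold boolean_algebra, ba_order in H.
apply and_elim in H; destruct H as [_ L]; apply and_elim in L; destruct L as [L _].
apply and_elim in L; destruct L as [L _].
kspec L Ha; push_in L; exact L.
Qed.

Lemma ba_le_antisym a b :
  tru (⟨⟨a, b⟩, a⟩ ∈ m) -> tru (⟨⟨b, a⟩, b⟩ ∈ m) -> a = b.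
Proof.
intros Hab Hba; destruct (ba_meet_mem Hab) as [Ha [Hb _]].
unfold boolean_algebra, ba_order in H.
apply and_elim in H; destruct H as [_ L]; apply and_elim in L; destruct L as [L _].
apply and_elim in L; destruct L as [_ L]; apply and_elim in L; destruct L as [L _].
kspec L Ha.
kspec L Hb.
push_in L; now apply eq_elim, (imp_elim L), tru_and.
Qed.

Lemma ba_le_trans a b c :
  tru (⟨⟨a, b⟩, a⟩ ∈ m) -> tru (⟨⟨b, c⟩, b⟩ ∈ m) -> tru (⟨⟨a, c⟩, a⟩ ∈ m).
Proof.
intros Hab Hbc; destruct (ba_meet_mem Hab) as [Ha [Hb _]].
destruct (ba_meet_mem Hbc) as [_ [Hc _]].
unfold boolean_algebra, ba_order in H.
apply and_elim in H; destruct H as [_ L]; apply and_elim in L; destruct L as [L _].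
apply and_elim in L; destruct L as [_ L]; apply and_elim in L; destruct L as [_ L].
kspec L Ha.
kspec L Hb.
kspec L Hc.
push_in L; now apply (imp_elim L), tru_and.
Qed.

Lemma ba_meet_glb a b c :
  tru (⟨⟨a, b⟩, c⟩ ∈ m) ->
  tru (⟨⟨c, a⟩, c⟩ ∈ m) /\ tru (⟨⟨c, b⟩, c⟩ ∈ m) /\
  forall d, tru (⟨⟨d, a⟩, d⟩ ∈ m) -> tru (⟨⟨d, b⟩, d⟩ ∈ m) ->
    tru (⟨⟨d, c⟩, d⟩ ∈ m).
Proof.
assert (M := ba_meet_mem); intros Habc; destruct (M _ _ _ Habc) as [Ha [Hb Hc]].
unfold boolean_algebra, ba_meets in H.
apply and_elim in H; destruct H as [_ L]; apply and_elim in L; destruct L as [_ L].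
apply and_elim in L; destruct L as [L _]; apply and_elim in L; destruct L as [L _].
kspec L Ha.
kspec L Hb.
kspec L Hc.
push_in L; pose proof (imp_elim L Habc) as P.
apply and_elim in P; destruct P as [P P']; apply and_elim in P'.
destruct P' as [P' P'']; repeat split; [exact P|exact P'|].
intros d Hda Hdb; destruct (M _ _ _ Hda) as [Hd _].
apply (all_elim d) in P''; push_in P''; pose proof (imp_elim P'' Hd) as Q.
now apply (imp_elim Q), tru_and.
Qed.

Lemma ba_le_top a : tru (a ∈ B) -> tru (⟨⟨a, e⟩, a⟩ ∈ m).
Proof.
intros Ha; unfold boolean_algebra, ba_meets in H.
apply and_elim in H; destruct H as [_ L]; apply and_elim in L; destruct L as [_ L].
apply and_elim in L; destruct L as [L _]; apply and_elim in L; destruct L as [_ L].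
kspec L Ha; push_in L; exact L.
Qed.

Lemma ba_neg_neg a b : tru (⟨a, b⟩ ∈ n) -> tru (⟨b, a⟩ ∈ n).
Proof.
intros Hab; pose proof (fun_dom ba_neg_function Hab) as Ha.
pose proof (fun_cod ba_neg_function Hab) as Hb.
unfold boolean_algebra, ba_involution in H.
apply and_elim in H; destruct H as [_ L]; apply and_elim in L; destruct L as [_ L].
apply and_elim in L; destruct L as [_ L]; apply and_elim in L; destruct L as [L _].
kspec L Ha.
kspec L Hb.
push_in L; now apply (imp_elim L).
Qed.

Lemma ba_meet_neg a b c :
  tru (⟨a, b⟩ ∈ n) -> tru (⟨⟨a, b⟩, c⟩ ∈ m) -> tru (⟨e, c⟩ ∈ n).
Proof.
intros Hab Habc; destruct (ba_meet_mem Habc) as [Ha [Hb Hc]].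
unfold boolean_algebra, ba_complement in H.
apply and_elim in H; destruct H as [_ L]; apply and_elim in L; destruct L as [_ L].
apply and_elim in L; destruct L as [_ L]; apply and_elim in L; destruct L as [_ L].
apply and_elim in L; destruct L as [L _].
kspec L Ha.
kspec L Hb.
kspec L Hc.
push_in L; now apply (imp_elim L), tru_and.
Qed.

Lemma ba_distrib a b c d u v w :
  tru (⟨⟨a, d⟩, u⟩ ∈ m) -> tru (⟨⟨a, b⟩, v⟩ ∈ m) -> tru (⟨⟨a, c⟩, w⟩ ∈ m) ->
  tru (⟨⟨b, c⟩, d⟩ ∈ ba_join m n) -> tru (⟨⟨v, w⟩, u⟩ ∈ ba_join m n).
Proof.
intros Hu Hv Hw Hd; destruct (ba_meet_mem Hu) as [Ha [Md Mu]].
destruct (ba_meet_mem Hv) as [_ [Hb Mv]].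
destruct (ba_meet_mem Hw) as [_ [Hc Mw]].
unfold boolean_algebra, ba_distributive in H.
apply and_elim in H; destruct H as [_ L]; apply and_elim in L; destruct L as [_ L].
apply and_elim in L; destruct L as [_ L]; apply and_elim in L; destruct L as [_ L].
apply and_elim in L; destruct L as [_ L].
kspec L Ha.
kspec L Hb.
kspec L Hc.
kspec L Md.
kspec L Mu.
kspec L Mv.
kspec L Mw.
push_in L; now apply (imp_elim L); rewrite !tru_and.
Qed.

End Laws.

Lemma ba_neg_total W X (B : W ~> pow X) e m n a :
  tru (boolean_algebra B e m n) -> tru (a ∈ B) -> tru (a ∈ dom n).
Proof. intros H; apply (fun_total (ba_neg_function H)). Qed.

Lemma ba_meet_total W X (B : W ~> pow X) e m n a b :
  tru (boolean_algebra B e m n) -> tru (a ∈ B) -> tru (b ∈ B) ->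
  tru (⟨a, b⟩ ∈ dom m).
Proof.
intros H Ha Hb; apply (fun_total (ba_meet_function H)).
now kand; split; push.
Qed.

(** The meet of [a] and its negation is 0 and lies below [a]. *)
Lemma ba_bottom_le W X (B : W ~> pow X) e m n z a :
  tru (boolean_algebra B e m n) -> tru (⟨e, z⟩ ∈ n) -> tru (a ∈ B) ->
  tru (⟨⟨z, a⟩, z⟩ ∈ m).
Proof.
intros H Hz Ha; assert (E := ba_neg_total H Ha); kval E b Hb.
assert (E := ba_meet_total H Ha (fun_cod (ba_neg_function H) Hb)).
kval E c Hc.
rewrite (fun_uniq (ba_neg_function H) Hz (ba_meet_neg H Hb Hc)).
apply (ba_meet_glb H Hc).
Qed.

(** Then [k] lies below the meet of [a] and its negation, which is 0. This is the contradiction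
    behind all later consistency arguments. *)
Lemma ba_le_both W X (B : W ~> pow X) e m n k a b :
  tru (boolean_algebra B e m n) -> tru (⟨a, b⟩ ∈ n) ->
  tru (⟨⟨k, a⟩, k⟩ ∈ m) -> tru (⟨⟨k, b⟩, k⟩ ∈ m) -> tru (⟨e, k⟩ ∈ n).
Proof.
intros H Hb Ka Kb; destruct (ba_meet_mem H Ka) as [Hk [Ha _]].
assert (E := ba_meet_total H Ha (fun_cod (ba_neg_function H) Hb)).
kval E c Hc; assert (Hz := ba_meet_neg H Hb Hc).
assert (E : k = c).
{ apply (ba_le_antisym H).
  - now apply (ba_meet_glb H Hc).
  - now apply (ba_bottom_le H). }
now rewrite E.
Qed.

(** By distributivity [k = k ∧ (a ∨ ¬ a) = 0 ∨ (k ∧ ¬ a) = k ∧ ¬ a]. The join is available only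
    through its De Morgan definition, so [0 ∨ w = w] is computed on negations. *)
Lemma ba_le_neg W X (B : W ~> pow X) e m n k a b z :
  tru (boolean_algebra B e m n) -> tru (⟨a, b⟩ ∈ n) ->
  tru (⟨⟨k, a⟩, z⟩ ∈ m) -> tru (⟨e, z⟩ ∈ n) -> tru (⟨⟨k, b⟩, k⟩ ∈ m).
Proof.
intros H Hb Ka Hz; destruct (ba_meet_mem H Ka) as [Hk [Ha _]].
assert (Mb := fun_cod (ba_neg_function H) Hb); assert (Hba := ba_neg_neg H Hb).
assert (E := ba_meet_total H Mb Ha); kval E c Hc.
assert (E := ba_meet_total H Hk Mb); kval E w Hw.
(* The join of [a] and [b] is [e]: their negations [b] and [a] meet in 0, whose negation is [e]. *)
assert (J := ba_join_intro Hb Hba Hc (ba_neg_neg H (ba_meet_neg H Hba Hc))).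
assert (J' := ba_distrib H (ba_le_top H Hk) Ka Hw J).
apply (ba_join_elim J'); intros V s p q r Hp Hq Hr Hs; shift s.
rewrite (fun_uniq (ba_neg_function H) Hp (ba_neg_neg H Hz)) in Hr.
assert (E : r = q).
{ destruct (ba_meet_glb H Hr) as [_ [L G]]; apply (ba_le_antisym H L).
  assert (Mq := fun_cod (ba_neg_function H) Hq).
  apply G; [now apply (ba_le_top H)|now apply (ba_le_refl H)]. }
subst r; rewrite <- (fun_uniq (ba_neg_function H) Hs (ba_neg_neg H Hq)) in Hw.
exact Hw.
Qed.

End BooleanAlgebras.
#[local] Hint Rewrite mem_ba_le : kj.

(** * Finite partial homomorphisms *)

Section FinitaryHomomorphisms.
Variables (T : topos) (two : T) (i0 i1 : one ~> two).
Hypothesis hT : boolean_topos T.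
Hypothesis cop : is_coproduct i0 i1.
Implicit Types (V W X : T).

Lemma nontrivial_top W X (e : W ~> X) (n : W ~> pow (X × X)) :
  tru (nontrivial e n) -> tru (¬ ⟨e, e⟩ ∈ n).
Proof.
intros H; knot L; unfold nontrivial in H; kinst H e; push_in H.
apply (imp_elim H) in L; apply (not_elim _ L); now apply tru_eq.
Qed.

(* [k] lies below every element that [f] sends to 1 and below the negation of
   every element that [f] sends to 0: any non-zero such [k] witnesses that [f]
   is a partial homomorphism. *)
Definition below_literals W X (m : W ~> pow (X × X × X)) (n : W ~> pow (X × X))
    (k : W ~> X) (f : W ~> pow (X × two)) : W ~> Omega :=
  (∀ x : X, ⟨x, const _ i1⟩ ∈ ↑f ⇒ ⟨⟨↑k, x⟩, ↑k⟩ ∈ ↑m) ∧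
  (∀ x : X, ∀ y : X,
     ⟨↑x, const _ i0⟩ ∈ ↑f ∧ ⟨↑x, y⟩ ∈ ↑n ⇒ ⟨⟨↑k, y⟩, ↑k⟩ ∈ ↑m).

Lemma below_literals_comp V W X (s : V ~> W) (m : W ~> pow (X × X × X))
    (n : W ~> pow (X × X)) (k : W ~> X) (f : W ~> pow (X × two)) :
  below_literals m n k f \o s =
  below_literals (m \o s) (n \o s) (k \o s) (f \o s).
Proof. unfold below_literals; natural. Qed.
Hint Rewrite below_literals_comp : kj.

Lemma below_literals_one W X (m : W ~> pow (X × X × X)) n k f x :
  tru (below_literals m n k f) -> tru (⟨x, const W i1⟩ ∈ f) ->
  tru (⟨⟨k, x⟩, k⟩ ∈ m).
Proof.
intros H Hx; apply and_elim in H; destruct H as [H _].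
kinst H x; push_in H; now apply (imp_elim H).
Qed.

Lemma below_literals_zero W X (m : W ~> pow (X × X × X)) n k f x y :
  tru (below_literals m n k f) -> tru (⟨x, const W i0⟩ ∈ f) ->
  tru (⟨x, y⟩ ∈ n) -> tru (⟨⟨k, y⟩, k⟩ ∈ m).
Proof.
intros H Hx Hy; apply and_elim in H; destruct H as [_ H].
kinst H x; kinst H y; push_in H; now apply (imp_elim H), tru_and.
Qed.

Definition nonzero W X (B : W ~> pow X) (e : W ~> X) (n : W ~> pow (X × X))
    (k : W ~> X) : W ~> Omega :=
  k ∈ B ∧ ¬ ⟨e, k⟩ ∈ n.

Lemma nonzero_comp V W X (s : V ~> W) (B : W ~> pow X) (e : W ~> X)
    (n : W ~> pow (X × X)) (k : W ~> X) :
  nonzero B e n k \o s = nonzero (B \o s) (e \o s) (n \o s) (k \o s).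
Proof. unfold nonzero; now push. Qed.
Hint Rewrite nonzero_comp : kj.

(** The induction invariant. Single-valuedness and preservation of the operations are not among the
    clauses, because both follow from [k'] being nonzero. *)
Definition decided W X (B : W ~> pow X) (e : W ~> X)
    (m : W ~> pow (X × X × X)) (n : W ~> pow (X × X)) (k : W ~> X)
    (S : W ~> pow X) (k' : W ~> X) (f : W ~> pow (X × two)) : W ~> Omega :=
  nonzero B e n k' ∧ ⟨⟨k', k⟩, k'⟩ ∈ m ∧
  f ∈ K (cart B full) ∧ subset S (dom f) ∧ below_literals m n k' f.

Lemma decided_comp V W X (s : V ~> W) (B : W ~> pow X) (e : W ~> X)
    (m : W ~> pow (X × X × X)) (n : W ~> pow (X × X)) (k : W ~> X)
    (S : W ~> pow X) (k' : W ~> X) (f : W ~> pow (X × two)) :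
  decided B e m n k S k' f \o s =
  decided (B \o s) (e \o s) (m \o s) (n \o s) (k \o s) (S \o s) (k' \o s)
    (f \o s).
Proof. unfold decided; now push. Qed.
Hint Rewrite decided_comp : kj.

Lemma tru_decided W X (B : W ~> pow X) e m n k S k' f :
  tru (decided B e m n k S k' f) <->
  tru (nonzero B e n k') /\ tru (⟨⟨k', k⟩, k'⟩ ∈ m) /\
  tru (f ∈ K (cart B full)) /\ tru (subset S (dom f)) /\
  tru (below_literals m n k' f).
Proof. unfold decided; now rewrite !tru_and. Qed.

Definition extensible W X (B : W ~> pow X) (e : W ~> X)
    (m : W ~> pow (X × X × X)) (n : W ~> pow (X × X)) (k : W ~> X)
    (S : W ~> pow X) : W ~> Omega :=
  ∃ k' : X, ∃ f : pow (X × two), decided ↑B ↑e ↑m ↑n ↑k ↑S ↑k' f.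

Lemma extensible_comp V W X (s : V ~> W) (B : W ~> pow X) (e : W ~> X)
    (m : W ~> pow (X × X × X)) (n : W ~> pow (X × X)) (k : W ~> X)
    (S : W ~> pow X) :
  extensible B e m n k S \o s =
  extensible (B \o s) (e \o s) (m \o s) (n \o s) (k \o s) (S \o s).
Proof. unfold extensible; natural. Qed.
Hint Rewrite extensible_comp : kj.

Lemma extensible_intro W X (B : W ~> pow X) e m n k S k' f :
  tru (decided B e m n k S k' f) -> tru (extensible B e m n k S).
Proof.
intros H; unfold extensible; rewrite <- comp_idr.
apply (ex_intro_at (a := k')); intros V s t.
apply (ex_intro_at (a := f \o s)); intros U u t'; push.
apply (tru_sub (s \o u)) in H; push_in H; exact H.
Qed.

Lemma extensible_elim W X (B : W ~> pow X) e m n k S (q : W ~> Omega) :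
  tru (extensible B e m n k S) ->
  (forall V (s : V ~> W) k' f,
    tru (decided (B \o s) (e \o s) (m \o s) (n \o s) (k \o s) (S \o s) k' f) ->
    tru (q \o s)) -> tru q.
Proof.
intros H Q; unfold extensible in H; kat H.
apply (ex_elim_at H); intros V s k' H1; cbv beta in H1.
apply (ex_elim_at H1); intros U u f H2; push_in H2; push.
specialize (Q _ (s \o u) (k' \o u) f); push_in Q; now apply Q.
Qed.

(** Quantifying over all nonzero [k], and not fixing [k = 1], lets the property pass to unions: the
    witness for one set becomes the starting point for the other. *)
Definition decidable W X (B : W ~> pow X) (e : W ~> X)
    (m : W ~> pow (X × X × X)) (n : W ~> pow (X × X)) (S : W ~> pow X)
  : W ~> Omega :=
  ∀ k : X, nonzero ↑B ↑e ↑n k ⇒ extensible ↑B ↑e ↑m ↑n k ↑S.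

Lemma decidable_comp V W X (s : V ~> W) (B : W ~> pow X) (e : W ~> X)
    (m : W ~> pow (X × X × X)) (n : W ~> pow (X × X)) (S : W ~> pow X) :
  decidable B e m n S \o s =
  decidable (B \o s) (e \o s) (m \o s) (n \o s) (S \o s).
Proof. unfold decidable; natural. Qed.
Hint Rewrite decidable_comp : kj.

Lemma decidable_elim W X (B : W ~> pow X) e m n S k :
  tru (decidable B e m n S) -> tru (nonzero B e n k) ->
  tru (extensible B e m n k S).
Proof.
intros H; unfold decidable in H; kinst H k; push_in H; apply (imp_elim H).
Qed.

Lemma decidable_empty W X (B : W ~> pow X) e m n :
  tru (boolean_algebra B e m n) -> tru (decidable B e m n empty).
Proof.
intros H; unfold decidable; kall k; kimp Hk.
assert (Hk' := Hk); unfold nonzero in Hk'; kand_in Hk' Hk''.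
apply (@extensible_intro _ _ _ _ _ _ _ _ k empty); apply tru_decided.
repeat split; [exact Hk|now apply (ba_le_refl H)|apply K_empty| |].
- apply empty_subset.
- unfold below_literals; kand; split.
  + kall x; kimp Hx; now apply bot_elim.
  + kall x; kall y; kimp Hx; kand_in Hx Hy; now apply bot_elim.
Qed.

Lemma decidable_single W X (B : W ~> pow X) e m n x :
  tru (boolean_algebra B e m n) -> tru (x ∈ B) ->
  tru (decidable B e m n (single x)).
Proof.
intros H Hx; unfold decidable; kall k; kimp Hk.
assert (L := Hk); unfold nonzero in L; kand_in L L'.
assert (E := ba_meet_total H L Hx); kval E d Hd.
assert (E := ba_neg_total H Hx); kval E y Hy.
assert (Md : tru (d ∈ B)) by apply (ba_meet_mem H Hd).
(* The only classical step. If [d = k ∧ x] is 0, then [k] is already below the negation of [x] and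
   [x] goes to 0; otherwise [d] is the new witness and [x] goes to 1. *)
assert (Z := excluded_middle hT (⟨e, d⟩ ∈ n)); kor Z.
- apply (@extensible_intro _ _ _ _ _ _ _ _ k (single ⟨x, const _ i0⟩)).
  apply tru_decided; repeat split.
  + exact Hk.
  + now apply (ba_le_refl H).
  + apply K_single; push; kand; split; [exact Hx|apply tru_top].
  + apply single_subset, (@dom_intro _ _ _ _ _ _ (const _ i0)).
    push; now apply tru_eq.
  + assert (Ky := ba_le_neg H Hy Hd Z).
    unfold below_literals; kand; split.
    * kall u; kimp Hu; apply eq_elim, tpair_inj in Hu; destruct Hu as [_ E].
      now apply (two_disjoint cop).
    * kall u; kall v; kimp Hu; kand_in Hu Hv.
      apply eq_elim, tpair_inj in Hu; destruct Hu as [-> _].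
      now rewrite (fun_uniq (ba_neg_function H) Hv Hy).
- apply (@extensible_intro _ _ _ _ _ _ _ _ d (single ⟨x, const _ i1⟩)).
  apply tru_decided; repeat split.
  + unfold nonzero; apply tru_and; now split.
  + apply (ba_meet_glb H Hd).
  + apply K_single; push; kand; split; [exact Hx|apply tru_top].
  + apply single_subset, (@dom_intro _ _ _ _ _ _ (const _ i1)).
    push; now apply tru_eq.
  + destruct (ba_meet_glb H Hd) as [_ [Dx _]].
    unfold below_literals; kand; split.
    * kall u; kimp Hu; apply eq_elim, tpair_inj in Hu.
      now destruct Hu as [-> _].
    * kall u; kall v; kimp Hu; kand_in Hu Hv.
      apply eq_elim, tpair_inj in Hu; destruct Hu as [_ E].
      now apply (two_disjoint cop).
Qed.

(** Literals lying above [k] also lie above the smaller [k']. *)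
Lemma below_literals_union W X (B : W ~> pow X) e m n k k' f f' :
  tru (boolean_algebra B e m n) -> tru (⟨⟨k', k⟩, k'⟩ ∈ m) ->
  tru (below_literals m n k f) -> tru (below_literals m n k' f') ->
  tru (below_literals m n k' (union f f')).
Proof.
intros H Hk Hf Hf'; unfold below_literals at 1; kand; split.
- kall x; kimp Hx; kor Hx.
  + exact (ba_le_trans H Hk (below_literals_one Hf Hx)).
  + exact (below_literals_one Hf' Hx).
- kall x; kall y; kimp Hx; kand_in Hx Hy; kor Hx.
  + exact (ba_le_trans H Hk (below_literals_zero Hf Hx Hy)).
  + exact (below_literals_zero Hf' Hx Hy).
Qed.

Lemma decidable_union W X (B : W ~> pow X) e m n S S' :
  tru (boolean_algebra B e m n) -> tru (decidable B e m n S) ->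
  tru (decidable B e m n S') -> tru (decidable B e m n (union S S')).
Proof.
intros H D D'; unfold decidable; kall k; kimp Hk.
apply (extensible_elim (decidable_elim D Hk)); intros V1 s k1 f1 L1; push_in L1; shift s.
apply tru_decided in L1; destruct L1 as [N1 [K1 [F1 [S1 G1]]]].
(* Starting from [k1] puts [k2] below it, so the choices made by [f1] remain valid. Overlaps of [f1]
   and [f2] cannot conflict, since both lie above the nonzero [k2]. *)
apply (extensible_elim (decidable_elim D' N1)); intros V2 s k2 f2 L2; push_in L2; shift s.
apply tru_decided in L2; destruct L2 as [N2 [K2 [F2 [S2 G2]]]].
apply (extensible_intro (k' := k2) (f := union f1 f2)), tru_decided.
repeat split; [exact N2|exact (ba_le_trans H K2 K1)|now apply K_union| |].
- unfold subset; kin x Hx; kor Hx.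
  + assert (E := subset_elim S1 Hx); kval E y Hy.
    apply (dom_intro (y := y)); push; now apply or_introl.
  + assert (E := subset_elim S2 Hx); kval E y Hy.
    apply (dom_intro (y := y)); push; now apply or_intror.
- exact (below_literals_union H K2 G1 G2).
Qed.

(** The inclusion in [B] is there because [subsemilattice] only admits families of subsets of
    [B]. *)
Definition decidable_subsets W X (B : W ~> pow X) (e : W ~> X)
    (m : W ~> pow (X × X × X)) (n : W ~> pow (X × X)) : W ~> pow (pow X) :=
  {{ S : pow X | subset S ↑B ∧ decidable ↑B ↑e ↑m ↑n S }}.

Lemma decidable_subsets_comp V W X (s : V ~> W) (B : W ~> pow X) (e : W ~> X)
    (m : W ~> pow (X × X × X)) (n : W ~> pow (X × X)) :
  decidable_subsets B e m n \o s =
  decidable_subsets (B \o s) (e \o s) (m \o s) (n \o s).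
Proof. unfold decidable_subsets; natural. Qed.

Lemma mem_decidable_subsets W X (B : W ~> pow X) e m n S :
  mem S (decidable_subsets B e m n) =
  and_ (subset S B) (decidable B e m n S).
Proof. unfold decidable_subsets; now push. Qed.
Hint Rewrite decidable_subsets_comp mem_decidable_subsets : kj.

Lemma decidable_finite W X (B : W ~> pow X) e m n S :
  tru (boolean_algebra B e m n) -> tru (S ∈ K B) -> tru (decidable B e m n S).
Proof.
intros H HS.
enough (L : tru (S ∈ decidable_subsets B e m n)).
{ push_in L; now apply tru_and in L. }
apply (K_elim HS); unfold subsemilattice; clear HS S.
repeat (apply tru_and; split).
- kin R HR; kand_in HR HR'; exact HR.
- push; apply tru_and; split; [apply empty_subset|now apply decidable_empty].
- kin x Hx; apply tru_and; split; [now apply single_subset|].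
  now apply decidable_single.
- kin R HR; kin R' HR'; kand_in HR D; kand_in HR' D'.
  apply tru_and; split; [now apply union_subset|now apply decidable_union].
Qed.

End FinitaryHomomorphisms.
#[local] Hint Rewrite below_literals_comp nonzero_comp decided_comp
  extensible_comp decidable_comp
  decidable_subsets_comp mem_decidable_subsets : kj.

Section Homomorphisms.
Variable T : topos.
Implicit Types (V W S Q X Y : T).

Lemma fiber_full W S Q (r : W ~> S) :
  fiber (full : W ~> pow (S × Q)) r = full.
Proof. apply pow_ext; intros V s x; push; now split; intros; apply tru_top. Qed.

Lemma preserves_elim W S Q X Y (Sg : W ~> pow S) (ar : W ~> pow (S × Q))
    (A : W ~> pow X) (I : W ~> pow (S × pow (Q × X)))
    (B : W ~> pow Y) (J : W ~> pow (S × pow (Q × Y))) f r a b :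
  tru (preserves Sg ar A I B J f) -> tru (r ∈ Sg) ->
  tru (is_function (fiber ar r) A a) -> tru (is_function (fiber ar r) B b) ->
  (forall V (s : V ~> W) i x y, tru (i ∈ fiber (ar \o s) (r \o s)) ->
     tru (⟨i, x⟩ ∈ (a \o s)) -> tru (⟨i, y⟩ ∈ (b \o s)) ->
     tru (⟨x, y⟩ ∈ (f \o s))) ->
  tru (⟨r, a⟩ ∈ I) -> tru (⟨r, b⟩ ∈ J).
Proof.
intros H Hr Ha Hb Hab HI; unfold preserves in H.
kspec H Hr; kinst H a; kinst H b; push_in H.
apply (imp_elim H); rewrite !tru_and; repeat split; [exact Ha|exact Hb| |exact HI].
clear H; apply tru_all; intros V s i; push; apply tru_imp; intros V1 s1 Hi.
push_in Hi; push; apply tru_all; intros V2 s2 x; push.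
apply tru_all; intros V3 s3 y; push; apply tru_imp; intros V4 s4 L.
push_in L; push; apply and_elim in L; destruct L as [L L'].
apply (tru_sub (s2 \o s3 \o s4)) in Hi; push_in Hi.
assert (K := Hab _ (s \o s1 \o s2 \o s3 \o s4) (i \o s1 \o s2 \o s3 \o s4)
  (x \o s3 \o s4) (y \o s4)).
push_in K; now apply K.
Qed.

End Homomorphisms.

(** * Maps above a nonzero element are partial homomorphisms to 2 *)

Section CSP.
Variables (T : topos) (two : T) (i0 i1 : one ~> two).
Hypothesis cop : is_coproduct i0 i1.
Implicit Types (V W X : T).

Lemma not2_irrefl W (x : W ~> two) (q : W ~> Omega) :
  tru (⟨x, x⟩ ∈ not2 W i0 i1) -> tru q.
Proof.
unfold not2; intros H; push_in H; kor H; kand_in H H';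
  apply eq_elim in H, H'; apply (two_disjoint cop); congruence.
Qed.

Lemma not2_01 W : tru (⟨const W i0, const W i1⟩ ∈ not2 W i0 i1).
Proof. unfold not2; push; apply or_introl, tru_and; now split; apply tru_eq. Qed.

Lemma not2_10 W : tru (⟨const W i1, const W i0⟩ ∈ not2 W i0 i1).
Proof. unfold not2; push; apply or_intror, tru_and; now split; apply tru_eq. Qed.

Lemma meet2_one W (y : W ~> two) :
  tru (⟨⟨const W i1, y⟩, y⟩ ∈ meet2 W i0 i1).
Proof. unfold meet2; push; apply or_introl, tru_and; now split; apply tru_eq. Qed.

Lemma meet2_zero W (y : W ~> two) :
  tru (⟨⟨const W i0, y⟩, const W i0⟩ ∈ meet2 W i0 i1).
Proof. unfold meet2; push; apply or_intror, tru_and; now split; apply tru_eq. Qed.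

Lemma meet2_zero_one W (y : W ~> two) (q : W ~> Omega) :
  tru (⟨⟨const W i0, y⟩, const W i1⟩ ∈ meet2 W i0 i1) -> tru q.
Proof.
unfold meet2; intros H; push_in H; kor H; kand_in H H';
  apply eq_elim in H, H'; apply (two_disjoint cop); congruence.
Qed.

(** Otherwise [k] would lie below both [x] and its negation and be 0. *)
Lemma literals_consistent W X (B : W ~> pow X) e m n k f x (q : W ~> Omega) :
  tru (boolean_algebra B e m n) -> tru (nonzero B e n k) ->
  tru (subset f (cart B full)) -> tru (below_literals i0 i1 m n k f) ->
  tru (⟨x, const W i0⟩ ∈ f) -> tru (⟨x, const W i1⟩ ∈ f) -> tru q.
Proof.
intros H Hk Hf Hl H0 H1; unfold nonzero in Hk; kand_in Hk Hk0.
assert (L := subset_elim Hf H0); push_in L; kand_in L L'.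
assert (E := ba_neg_total H L); kval E y Hy.
apply (not_elim _ Hk0), (ba_le_both H Hy).
- exact (below_literals_one Hl H1).
- exact (below_literals_zero Hl H0 Hy).
Qed.

Lemma literals_single_valued W X (B : W ~> pow X) e m n k f :
  tru (boolean_algebra B e m n) -> tru (nonzero B e n k) ->
  tru (subset f (cart B full)) -> tru (below_literals i0 i1 m n k f) ->
  tru (single_valued f).
Proof.
intros H Hk Hf Hl; unfold single_valued.
kall3 x y y'; kimp L; kand_in L L'; kcase cop y; kcase cop y'.
- now apply tru_eq.
- exact (literals_consistent _ H Hk Hf Hl L L').
- exact (literals_consistent _ H Hk Hf Hl L' L).
- now apply tru_eq.
Qed.

(** Each wrong assignment of truth values puts [k] below an element and its negation. For the meet
    this element is [a] or [b] when [c] is wrongly sent to 1 (as [k ≤ c]), and [c] when it is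
    wrongly sent to 0 (as [k ≤ a] and [k ≤ b]). For the negation it is [a]. *)
Lemma literals_preserve_ops W X (B : W ~> pow X) e m n k f a b c d a' b' c' d' :
  tru (boolean_algebra B e m n) -> tru (nonzero B e n k) ->
  tru (below_literals i0 i1 m n k f) ->
  tru (⟨⟨a, b⟩, c⟩ ∈ m) -> tru (⟨a, d⟩ ∈ n) ->
  tru (⟨a, a'⟩ ∈ f) -> tru (⟨b, b'⟩ ∈ f) ->
  tru (⟨c, c'⟩ ∈ f) -> tru (⟨d, d'⟩ ∈ f) ->
  tru (⟨⟨a', b'⟩, c'⟩ ∈ meet2 W i0 i1 ∧ ⟨a', d'⟩ ∈ not2 W i0 i1).
Proof.
intros H Hk Hl Hc Hd Fa Fb Fc Fd; unfold nonzero in Hk; kand_in Hk Hk0.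
assert (E := ba_neg_total H (proj1 (proj2 (ba_meet_mem H Hc)))); kval E nb Hnb.
assert (E := ba_neg_total H (proj2 (proj2 (ba_meet_mem H Hc)))); kval E nc Hnc.
destruct (ba_meet_glb H Hc) as [Lca [Lcb _]].
apply tru_and; split.
- clear Fd d'; kcase cop a'.
  + kcase cop c'; [apply meet2_zero|].
    apply (not_elim _ Hk0), (ba_le_both H Hd).
    * exact (ba_le_trans H (below_literals_one Hl Fc) Lca).
    * exact (below_literals_zero Hl Fa Hd).
  + kcase cop b'; kcase cop c'; [apply meet2_one| | |apply meet2_one];
      apply (not_elim _ Hk0).
    * apply (ba_le_both H Hnb).
      -- exact (ba_le_trans H (below_literals_one Hl Fc) Lcb).
      -- exact (below_literals_zero Hl Fb Hnb).
    * apply (ba_le_both H Hnc).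
      -- apply (ba_meet_glb H Hc); eapply below_literals_one; eassumption.
      -- exact (below_literals_zero Hl Fc Hnc).
- clear Fb Fc b' c'; kcase cop a'; kcase cop d';
    [|apply not2_01|apply not2_10|]; apply (not_elim _ Hk0), (ba_le_both H Hd).
  + exact (below_literals_zero Hl Fd (ba_neg_neg H Hd)).
  + exact (below_literals_zero Hl Fa Hd).
  + exact (below_literals_one Hl Fa).
  + exact (below_literals_one Hl Fd).
Qed.

End CSP.

(** * Homomorphisms of Boolean algebras from Axiom CSP *)

Lemma mem_finitary_homs (T : topos) (W S Q X Y : T)
    (Sg : W ~> pow S) (ar : W ~> pow (S × Q))
    (A : W ~> pow X) (I : W ~> pow (S × pow (Q × X)))
    (B : W ~> pow Y) (J : W ~> pow (S × pow (Q × Y))) f :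
  mem f (finitary_homs Sg ar A I B J) = finitary_homomorphism Sg ar A I B J f.
Proof. unfold finitary_homs; now push. Qed.
#[local] Hint Rewrite fiber_full mem_finitary_homs : kj.

(** The axiom holds at the terminal stage and is pulled back along [bang], so it applies to
    structures in any context. The homomorphism exists only internally, hence the goal [q]. *)
Lemma CSP_elim (T : topos) (hC : Axiom_CSP T) (W S Q X Y : T)
    (Sg : W ~> pow S) (ar : W ~> pow (S × Q)) (lt : W ~> pow (S × (Q × Q)))
    (A : W ~> pow X) (I : W ~> pow (S × pow (Q × X)))
    (D : W ~> pow Y) (ltD : W ~> pow (Y × Y)) (J : W ~> pow (S × pow (Q × Y)))
    (q : W ~> Omega) :
  tru (signature Sg ar lt) -> tru (structure Sg ar A I) ->
  tru (structure Sg ar D J) -> tru (finite_cardinal D ltD) ->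
  tru (jointly_total A (finitary_homs Sg ar A I D J)) ->
  (forall V (s : V ~> W) h,
     tru (homomorphism (Sg \o s) (ar \o s) (A \o s) (I \o s) (D \o s) (J \o s) h)
     -> tru (q \o s)) ->
  tru q.
Proof.
intros H1 H2 H3 H4 H5 Q'.
assert (L := tru_sub (@bang T W) (hC S Q X Y)).
kinst L Sg; kinst L ar; kinst L lt; kinst L A; kinst L I.
kinst L D; kinst L ltD; kinst L J.
rewrite imp_comp in L; lapply (imp_elim L); clear L; [intros L|].
- rewrite iff_comp in L; unfold iff_ in L; apply and_elim in L.
  destruct L as [_ L]; lapply (imp_elim L); clear L; [intros L|push; exact H5].
  apply (ex_elim_at L); intros V s h Hh; push_in Hh; now apply (Q' V s h).
- push; rewrite !tru_and; auto.
Qed.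

(** The tuples [a] and [b] live at a stage [V], while their entries are compared at every later
    stage [U], as the internal quantifier over positions demands. *)
Lemma preserves_intro (T : topos) (W S Q X Y : T)
    (Sg : W ~> pow S) (ar : W ~> pow (S × Q))
    (A : W ~> pow X) (I : W ~> pow (S × pow (Q × X)))
    (B : W ~> pow Y) (J : W ~> pow (S × pow (Q × Y))) f :
  (forall V (s : V ~> W) r a b, tru (r ∈ (Sg \o s)) ->
     tru (is_function (fiber (ar \o s) r) (A \o s) a) ->
     tru (is_function (fiber (ar \o s) r) (B \o s) b) ->
     (forall U (u : U ~> V) i x y, tru (⟨r \o u, i⟩ ∈ (ar \o s \o u)) ->
        tru (⟨i, x⟩ ∈ (a \o u)) -> tru (⟨i, y⟩ ∈ (b \o u)) ->
        tru (⟨x, y⟩ ∈ (f \o s \o u))) ->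
     tru (⟨r, a⟩ ∈ (I \o s)) -> tru (⟨r, b⟩ ∈ (J \o s))) ->
  tru (preserves Sg ar A I B J f).
Proof.
intros H; unfold preserves, all_in_ at 1; rewrite <- comp_idr.
kdelay r s1; apply imp_intro_at; intros V2 s2 Hr.
kdelay a s3; kdelay b s4; apply imp_intro_at; intros V s L.
rewrite !and_comp in L; apply and_elim in L; destruct L as [Ha L].
apply and_elim in L; destruct L as [Hb L].
apply and_elim in L; destruct L as [Hab HI].
push_in Hr; push_in Ha; push_in Hb; push_in HI; push.
apply (tru_sub (s3 \o s4 \o s)) in Hr; push_in Hr.
specialize (H _ (s1 \o s2 \o s3 \o s4 \o s) (r \o s2 \o s3 \o s4 \o s)
  (a \o s4 \o s) (b \o s)).
push_in H; apply H; try assumption.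
intros V' u i x y Hi Hx Hy; clear H.
apply (tru_sub u) in Hab; rewrite <- comp_assoc in Hab.
push_in Hx; push_in Hy; push_in Hi; push.
apply (all_in_elim_at (a := i)) in Hab; [|push; exact Hi]; cbv beta in Hab.
kinst Hab x; kinst Hab y; push_in Hab; now apply (imp_elim Hab), tru_and.
Qed.

Section BooleanHomomorphisms.
Variables (T : topos) (two : T) (i0 i1 : one ~> two).
Hypothesis hT : boolean_topos T.
Hypothesis cop : is_coproduct i0 i1.
Implicit Types (V W X : T).

(** The signature is [full] on [one], with arity relation [full], so the fiber over its only symbol
    is all of [two × two]; this is the order on that fiber. *)
Definition arity_order W : W ~> pow (one × ((two × two) × (two × two))) :=
  {{ p : one × ((two × two) × (two × two)) |
     tsnd p ∈ lex (lt2 i0 i1 _) (lt2 i0 i1 _) }}.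

Lemma arity_order_comp V W (s : V ~> W) : arity_order W \o s = arity_order V.
Proof. unfold arity_order; now push. Qed.

Lemma fiber_arity_order W (r : W ~> one) :
  fiber (arity_order W) r = lex (lt2 i0 i1 W) (lt2 i0 i1 W).
Proof.
apply pow_ext; intros V s p; push; rewrite arity_order_comp.
unfold arity_order; now push.
Qed.
Hint Rewrite arity_order_comp fiber_arity_order : kj.

Lemma arity_signature W : tru (signature full full (arity_order W)).
Proof.
unfold signature; kin r Hr; exact (finite_cardinal_two_square cop _).
Qed.

Lemma op_structure W X (A : W ~> pow X) m n :
  tru (structure full full A (op_graph i0 i1 A m n)).
Proof.
unfold structure; kin r Hr; kin t Ht; now apply mem_op_graph in Ht.
Qed.

Lemma literals_preserve_op_graph W X (B : W ~> pow X) e m n k f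
    r t t' a b c d a' b' c' d' :
  tru (boolean_algebra B e m n) -> tru (nonzero B e n k) ->
  tru (below_literals i0 i1 m n k f) ->
  (forall i x y, tru (⟨i, x⟩ ∈ t) -> tru (⟨i, y⟩ ∈ t') ->
     tru (⟨x, y⟩ ∈ f)) ->
  tru (⟨r, t⟩ ∈ op_graph i0 i1 B m n) -> tru (is_function full full t') ->
  tru (reads i0 i1 t a b c d) -> tru (reads i0 i1 t' a' b' c' d') ->
  tru (⟨r, t'⟩ ∈ op_graph i0 i1 full (meet2 W i0 i1) (not2 W i0 i1)).
Proof.
intros H Hk Hl F Hm Ht' R R'; destruct (op_graph_elim Hm R) as [Hc Hd].
assert (R1 := R); assert (R1' := R'); rewrite tru_reads in R1, R1'.
destruct R1 as [[Ra Rb] [Rc Rd]], R1' as [[Ra' Rb'] [Rc' Rd']].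
assert (L := literals_preserve_ops cop H Hk Hl Hc Hd
  (F _ _ _ Ra Ra') (F _ _ _ Rb Rb') (F _ _ _ Rc Rc') (F _ _ _ Rd Rd')).
apply and_elim in L; destruct L as [L L'].
exact (op_graph_intro _ Ht' R' L L').
Qed.

Lemma decided_finitary_homomorphism W X (B : W ~> pow X) e m n k S k' f :
  tru (boolean_algebra B e m n) -> tru (decided i0 i1 B e m n k S k' f) ->
  tru (finitary_homomorphism full full B (op_graph i0 i1 B m n)
    full (op_graph i0 i1 full (meet2 W i0 i1) (not2 W i0 i1)) f).
Proof.
intros H D; apply tru_decided in D; destruct D as [Hk [_ [HK [_ Hl]]]].
assert (Hf := K_subset HK).
unfold finitary_homomorphism, relational_homomorphism; rewrite !tru_and.
repeat split; [exact HK|exact (literals_single_valued cop H Hk Hf Hl)|exact Hf|].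
clear HK Hf S k; apply preserves_intro; intros V s r t t' _ Ht Ht' F Hm.
push_in Ht; push_in Ht'; push_in Hm; push.
(* The entries of the two tuples exist only locally, so both are read off before the relation is
   checked. *)
apply (reads_total (i0 := i0) (i1 := i1) Ht'); intros V1 s1 a' b' c' d' R'.
apply (tru_sub s1) in Ht; push_in Ht.
apply (reads_total (i0 := i0) (i1 := i1) Ht); intros V2 s2 a b c d R.
apply (tru_sub s2) in R'; push_in R'.
apply (tru_sub (s1 \o s2)) in Hm, Ht'; push_in Hm; push_in Ht'; push_in R.
apply (tru_sub (s \o s1 \o s2)) in H, Hk, Hl; push_in H; push_in Hk; push_in Hl.
push; refine (literals_preserve_op_graph H Hk Hl _ Hm Ht' R R').
intros i x y Hx Hy; specialize (F _ (s1 \o s2) i x y); push_in F.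
now apply F; [apply tru_top|..].
Qed.

Lemma finitary_homs_jointly_total W X (B : W ~> pow X) e m n :
  tru (boolean_algebra B e m n) -> tru (nontrivial e n) ->
  tru (jointly_total B (finitary_homs full full B (op_graph i0 i1 B m n)
    full (op_graph i0 i1 full (meet2 W i0 i1) (not2 W i0 i1)))).
Proof.
intros H N; unfold jointly_total; kin A0 HA0.
assert (D := decidable_finite hT cop H HA0).
(* The construction starts from [k = 1], which is nonzero because the algebra is non-trivial. *)
assert (He : tru (nonzero B e n e))
  by (apply tru_and; split; [exact (ba_top_mem H)|now apply nontrivial_top]).
apply (extensible_elim (decidable_elim D He)); clear D.
intros V s k f D; push_in D; shift s.
kexists f; apply tru_and; split.
- exact (decided_finitary_homomorphism H D).
- now apply tru_decided in D.
Qed.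

Lemma homomorphism_function W X (B : W ~> pow X) m n h :
  tru (homomorphism full full B (op_graph i0 i1 B m n)
    full (op_graph i0 i1 full (meet2 W i0 i1) (not2 W i0 i1)) h) ->
  tru (is_function B full h).
Proof. intros Hh; now apply and_elim in Hh. Qed.

(** Preservation of the quaternary relation, applied to the explicit tuples of [a, b, c, d] and of
    their images. The images match slot by slot because tuples are functions. *)
Lemma homomorphism_ops W X (B : W ~> pow X) m n h a b c d a' b' c' d' :
  tru (homomorphism full full B (op_graph i0 i1 B m n)
    full (op_graph i0 i1 full (meet2 W i0 i1) (not2 W i0 i1)) h) ->
  tru (⟨⟨a, b⟩, c⟩ ∈ m) -> tru (⟨a, d⟩ ∈ n) ->
  tru (⟨a, a'⟩ ∈ h) -> tru (⟨b, b'⟩ ∈ h) ->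
  tru (⟨c, c'⟩ ∈ h) -> tru (⟨d, d'⟩ ∈ h) ->
  tru (⟨⟨a', b'⟩, c'⟩ ∈ meet2 W i0 i1) /\ tru (⟨a', d'⟩ ∈ not2 W i0 i1).
Proof.
intros Hh Hc Hd Ha' Hb' Hc' Hd'; assert (HF := homomorphism_function Hh).
assert (Ht : tru (is_function full B (quadruple i0 i1 a b c d)))
  by (apply (quadruple_function cop); eapply (fun_dom HF); eassumption).
assert (Ht' : tru (is_function full full (quadruple i0 i1 a' b' c' d')))
  by (apply (quadruple_function cop); push; apply tru_top).
assert (R := reads_quadruple i0 i1 a b c d).
assert (R' := reads_quadruple i0 i1 a' b' c' d').
apply and_elim in Hh; destruct Hh as [_ P].
refine (op_graph_elim (r := @bang T W) (preserves_elim P _ _ _ _ _) R').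
- push; apply tru_top.
- push; exact Ht.
- push; exact Ht'.
- clear P HF Hc Hd; intros V s i x y _ Hx Hy.
  apply tru_reads in R, R'.
  destruct R as [[R1 R2] [R3 R4]], R' as [[R1' R2'] [R3' R4']].
  push_in Hx; push_in Hy; shift s.
  kpair i j k; kcase cop j; kcase cop k.
  + now rewrite (fun_uniq Ht Hx R1), (fun_uniq Ht' Hy R1').
  + now rewrite (fun_uniq Ht Hx R2), (fun_uniq Ht' Hy R2').
  + now rewrite (fun_uniq Ht Hx R3), (fun_uniq Ht' Hy R3').
  + now rewrite (fun_uniq Ht Hx R4), (fun_uniq Ht' Hy R4').
- exact (op_graph_intro _ Ht R Hc Hd).
Qed.

Lemma homomorphism_ba_homomorphism W X (B : W ~> pow X) e m n h :
  tru (boolean_algebra B e m n) ->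
  tru (homomorphism full full B (op_graph i0 i1 B m n)
    full (op_graph i0 i1 full (meet2 W i0 i1) (not2 W i0 i1)) h) ->
  tru (ba_homomorphism B e m n
    full (const W i1) (meet2 W i0 i1) (not2 W i0 i1) h).
Proof.
intros H Hh; unfold ba_homomorphism; rewrite !tru_and; repeat split.
- exact (homomorphism_function Hh).
- assert (E := fun_total (homomorphism_function Hh) (ba_top_mem H)).
  kval E y Hy.
  assert (E := ba_neg_total H (ba_top_mem H)); kval E z Hz.
  assert (Mz := fun_cod (ba_neg_function H) Hz).
  assert (E := ba_meet_total H (ba_top_mem H) Mz); kval E c Hc.
  assert (E := fun_uniq (ba_neg_function H) (ba_meet_neg H Hz Hc) Hz); subst c.
  assert (E := fun_total (homomorphism_function Hh) Mz); kval E y' Hy'.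
  (* The quadruple is [1, 0, 0, 0], with images [y, y', y', y']. If [y] were 0, then [¬ 0 = y']
     would exclude [y' = 0], and [0 ∧ y' = y'] would exclude [y' = 1]. *)
  destruct (homomorphism_ops Hh Hc Hz Hy Hy' Hy' Hy') as [L L'].
  kcase cop y; [kcase cop y'|exact Hy].
  + exact (not2_irrefl cop _ L').
  + exact (meet2_zero_one cop _ L).
- rewrite <- comp_idr; kdelay a f1; kdelay b f2; kdelay c f3.
  kdelay a' f4; kdelay b' f5; kdelay c' f6.
  shift f1; shift f2; shift f3; shift f4; shift f5; shift f6; kimp L.
  rewrite !tru_and in L; destruct L as [Ha [Hb [Hc Hm]]].
  (* The relation speaks of quadruples, so a meet is completed by the negation of [a] and its
     image. *)
  assert (E := ba_neg_total H (proj1 (ba_meet_mem H Hm))); kval E d Hd.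
  assert (Md := fun_cod (ba_neg_function H) Hd).
  assert (E := fun_total (homomorphism_function Hh) Md); kval E d' Hd'.
  now apply (homomorphism_ops Hh Hm Hd Ha Hb Hc Hd').
- rewrite <- comp_idr; kdelay a f1; kdelay b f2; kdelay a' f3; kdelay b' f4.
  shift f1; shift f2; shift f3; shift f4; kimp L.
  rewrite !tru_and in L; destruct L as [Ha [Hb Hn]].
  assert (Ma := fun_dom (ba_neg_function H) Hn).
  (* A negation is completed by the meet of [a] with itself. *)
  assert (E := ba_meet_total H Ma Ma); kval E c Hc.
  destruct (ba_meet_mem H Hc) as [_ [_ Mc]].
  assert (E := fun_total (homomorphism_function Hh) Mc); kval E c' Hc'.
  now apply (homomorphism_ops Hh Hc Hn Ha Ha Hc' Hb).
Qed.

End BooleanHomomorphisms.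

Theorem theorem3p1 (T : topos) (hT : boolean_topos T) :
  Axiom_CSP T -> Axiom_BPIT T.
Proof.
intros hC two i0 i1 cop X; unfold valid.
match goal with |- ?p = _ => change (tru p) end.
rewrite <- comp_idr; kdelay B f1; kdelay e f2; kdelay m f3; kdelay n f4.
apply imp_intro_at; intros W f5 H; push_in H; push.
clear f1; shift f2; shift f3; shift f4; shift f5.
apply and_elim in H; destruct H as [H N].
(* The algebra and [two], both encoded by [op_graph], are the two structures; the order [lt2] makes
   [two] a finite cardinal. *)
apply (CSP_elim hC (arity_signature cop _) (op_structure i0 i1 B m n)
  (op_structure i0 i1 full (meet2 _ i0 i1) (not2 _ i0 i1))
  (finite_cardinal_two cop _) (finitary_homs_jointly_total hT cop H N)).
intros V' s h Hh; push_in Hh; shift s.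
kexists h; exact (homomorphism_ba_homomorphism cop H Hh).
Qed.
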